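(* The nonvariational finite element solution, i.e. the function $U\in\mathring{\mathbb V}$ with $$\langle \boldsymbol A:\boldsymbol H[U],\mathring\Phi\rangle=\langle f,\mathring\Phi\rangle\quad\text{for all }\mathring\Phi\in\mathring{\mathbb V},$$ is given as $U=\mathring{\boldsymbol\Phi}^{\mathsf T}\boldsymbol u$, where $\boldsymbol u\in\mathbb R^{\mathring N}$ is the solution of the linear system $$\boldsymbol D\boldsymbol u:=\sum_{\alpha=1}^d\sum_{\beta=1}^d\boldsymbol B^{\alpha,\beta}\boldsymbol M^{-1}\boldsymbol C_{\alpha,\beta}\,\boldsymbol u=\boldsymbol f ;$$ that is, $U=\mathring{\boldsymbol\Phi}^{\mathsf T}\boldsymbol u$ satisfies the discrete problem if and only if $\boldsymbol D\boldsymbol u=\boldsymbol f$. Here $$\boldsymbol B^{\alpha,\beta}:=\langle\mathring{\boldsymbol\Phi},\boldsymbol A^{\alpha,\beta}\boldsymbol\Phi^{\mathsf T}\rangle\in\mathbb R^{\mathring N\times N},\qquad \boldsymbol M:=\langle\boldsymbol\Phi,\boldsymbol\Phi^{\mathsf T}\rangle\in\mathbb R^{N\times N},$$ $$\boldsymbol C_{\alpha,\beta}:=-\langle\partial_\beta\boldsymbol\Phi,\partial_\alpha\mathring{\boldsymbol\Phi}^{\mathsf T}\rangle+\langle\boldsymbol\Phi\,n_\beta,\partial_\alpha\mathring{\boldsymbol\Phi}^{\mathsf T}\rangle_{\partial\Omega}\in\mathbb R^{N\times\mathring N},\qquad \boldsymbol f:=\langle f,\mathring{\boldsymbol\Phi}\rangle\in\mathbb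 R^{\mathring N}.$$
   Context: Let $\Omega\subset\mathbb R^d$ be an open bounded Lipschitz domain with outward pointing unit normal $\boldsymbol n=(n_1,\dots,n_d)$ on $\partial\Omega$. Let $\boldsymbol A=[\boldsymbol A^{\alpha,\beta}]_{\alpha,\beta=1}^d\in L_\infty(\Omega)^{d\times d}$ be symmetric positive definite matrix valued, such that the operator $u\mapsto\boldsymbol A:\mathrm D^2u$ is uniformly elliptic, and let $f\in L_2(\Omega)$. The Frobenius product is $\boldsymbol X:\boldsymbol Y:=\operatorname{trace}(\boldsymbol X^{\mathsf T}\boldsymbol Y)$. The model problem being discretized is $\boldsymbol A:\mathrm D^2u=f$ in $\Omega$, $u=0$ on $\partial\Omega$. Let $\mathscr T$ be a conforming triangulation of $\Omega$: a finite family of open simplices (segments for $d=1$, triangles for $d=2$, tetrahedra for $d=3$) such that for any $K,J\in\mathscr T$ the set $\overline K\cap\overline J$ is a full subsimplex (either $\emptyset$, a vertex, an edge, a face, or the whole of $\overline K$ and $\overline J$) of both $\overline K$ and $\overline J$, and $\bigcup_{K\in\mathscr T}\overline K=\overline\Omega$. Fix an integer $p\ge1$, let $\mathbb P^p$ be the polynomials in $d$ variables of degree at most $p$, and put $$\mathbb V:=\{\Phi\in H^1(\Omega):\Phi|_K\in\mathbb P^p\ \forall K\in\mathscr T\},\qquad\mathring{\mathbb V}:=\mathbb V\cap H^1_0(\Omega),$$ $\mathring N:=\dim\mathring{\mathbb V}$, $N:=\dim\mathbb V=\mathring N+N_\partial$. Let $\mathring{\boldsymbol\Phi}=(\mathring\Phi_1,\dots,\mathring\Phi_{\mathring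 N})^{\mathsf T}$ be the column vector of a basis of $\mathring{\mathbb V}$, and $\boldsymbol\Phi=(\mathring\Phi_1,\dots,\mathring\Phi_{\mathring N},\Phi_1,\dots,\Phi_{N_\partial})^{\mathsf T}$ that of a basis of $\mathbb V$ extending it. Notation: $\langle v,w\rangle:=\int_\Omega vw$ and $\langle v,w\rangle_{\partial\Omega}:=\int_{\partial\Omega}vw$, applied entrywise to (matrix) products of vectors/matrices of functions; on $\partial\Omega$ derivatives of finite element functions are traces of the piecewise polynomial derivatives from the adjacent elements. Also $\boldsymbol x\otimes\boldsymbol y:=\boldsymbol x\boldsymbol y^{\mathsf T}$, and gradients are column vectors. Finite element Hessian: for $V\in\mathring{\mathbb V}$, $\boldsymbol H[V]=[\boldsymbol H_{\alpha,\beta}[V]]_{\alpha,\beta=1}^d\in\mathbb V^{d\times d}$ is the unique element such that $$\int_\Omega\boldsymbol H[V]\,\Phi=-\int_\Omega\nabla V\otimes\nabla\Phi+\int_{\partial\Omega}\nabla V\otimes\boldsymbol n\,\Phi\quad\text{for all }\Phi\in\mathbb V.$$ *)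

(* Defs.v *)
From HB Require Import structures.
From mathcomp Require Import all_boot all_order all_algebra.
From mathcomp Require mpoly.
From mathcomp Require Import all_classical all_reals all_analysis.
(* The notations of mpoly clash with those of mathcomp-analysis. *)
Import (canonicals, coercions) mpoly.

Set Implicit Arguments.
Unset Strict Implicit.
Unset Printing Implicit Defensive.

Import Order.TTheory GRing.Theory Num.Theory.
Import numFieldNormedType.Exports.

Local Open Scope classical_set_scope.
Local Open Scope ring_scope.

Definition rV_display : measure_display -> measure_display.
Proof. exact. Qed.

(* The product (= Borel) sigma-algebra of R^n, as the library has it on tuples. *)
Section measurable_rV.
Context {R : realType} (n : nat).

Let coord (i : 'I_n) (x : 'rV[R]_n) : R := x 0 i.

Let rV_set0 : g_sigma_preimage coord set0.
Proof. exact: sigma_algebra0. Qed.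

Let rV_setC A : g_sigma_preimage coord A -> g_sigma_preimage coord (~` A).
Proof. exact: sigma_algebraC. Qed.

Let rV_bigcup (F : (set 'rV[R]_n)^nat) :
  (forall i, g_sigma_preimage coord (F i)) ->
  g_sigma_preimage coord (\bigcup_i (F i)).
Proof. exact: sigma_algebra_bigcup. Qed.

HB.instance Definition _ :=
  @isMeasurable.Build (rV_display default_measure_display)
    'rV[R]_n (g_sigma_preimage coord) rV_set0 rV_setC rV_bigcup.

End measurable_rV.

Section lebesgue_rV.
Context {R : realType}.

Lemma measurable_coord n (i : 'I_n) :
  measurable_fun [set: 'rV[R]_n] (fun x => x 0 i).
Proof.
move=> _ Y mY; rewrite setTI; apply: sub_sigma_algebra => /=.
rewrite -bigcup_seq/=; exists i => /=; first by rewrite mem_index_enum.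
by exists Y => //; rewrite setTI.
Qed.

Lemma measurable_fun_rVP d (T : measurableType d) n (f : T -> 'rV[R]_n) :
  (forall i, measurable_fun [set: T] (fun x => f x 0 i)) ->
  measurable_fun [set: T] f.
Proof.
move=> mf _ A mA.
suff : g_sigma_preimage (fun i => (fun x : 'rV[R]_n => x 0 i) \o f)
    `<=` measurable.
  by rewrite g_sigma_preimage_comp; apply; exists A.
apply: smallest_sub; first exact: sigma_algebra_measurable.
rewrite -bigcup_seq/=; apply: bigcup_sub => i _ _ [B mB <-].
exact: mf.
Qed.

Definition rV_cons n (p : R * 'rV[R]_n) : 'rV[R]_n.+1 :=
  \row_i (if unlift ord0 i is Some j then p.2 0 j else p.1).

Definition rV_uncons n (x : 'rV[R]_n.+1) : R * 'rV[R]_n :=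
  (x 0 ord0, \row_j x 0 (lift ord0 j)).

Lemma rV_consK n : cancel (@rV_cons n) (@rV_uncons n).
Proof.
case=> x v; rewrite /rV_uncons mxE unlift_none; congr pair.
by apply/rowP => j; rewrite !mxE liftK.
Qed.

Lemma rV_unconsK n : cancel (@rV_uncons n) (@rV_cons n).
Proof.
move=> x; apply/rowP => i; rewrite mxE.
by case: unliftP => [j|] ->; rewrite ?mxE.
Qed.

Lemma measurable_rV_cons n :
  measurable_fun [set: measurableTypeR R * 'rV[R]_n] (@rV_cons n).
Proof.
apply: measurable_fun_rVP => i; case: (unliftP ord0 i) => [j|] ->.
  under eq_fun do rewrite mxE liftK.
  by apply: (measurableT_comp (measurable_coord j)); exact: measurable_snd.
under eq_fun do rewrite mxE unlift_none.
exact: measurable_fst.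
Qed.

Lemma measurable_rV_uncons n :
  measurable_fun [set: 'rV[R]_n.+1]
    (@rV_uncons n : _ -> measurableTypeR R * 'rV[R]_n).
Proof.
apply/measurable_fun_pairP; split; first exact: measurable_coord.
apply: measurable_fun_rVP => i.
by under eq_fun do rewrite mxE; exact: measurable_coord.
Qed.

Section step.
Context n (m : {sigma_finite_measure set 'rV[R]_n -> \bar R}).

Definition lebesgue_rV_step : set 'rV[R]_n.+1 -> \bar R :=
  pushforward (lebesgue_measure \x m)%E (@rV_cons n).

Let step0 : lebesgue_rV_step set0 = 0%E.
Proof. by rewrite /lebesgue_rV_step /pushforward preimage_set0 measure0. Qed.

Let step_ge0 A : (0 <= lebesgue_rV_step A)%E.
Proof. by apply: integral_ge0 => x _; exact: measure_ge0. Qed.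

Let step_sigma_additive : semi_sigma_additive lebesgue_rV_step.
Proof.
move=> F mF tF mUF; rewrite /lebesgue_rV_step /pushforward preimage_bigcup.
have mcons A : measurable A -> measurable (@rV_cons n @^-1` A).
  by move=> mA; rewrite -[X in measurable X]setTI; exact: measurable_rV_cons.
apply: measure_semi_sigma_additive.
- by move=> k; exact: mcons.
- apply/trivIsetP => /= i j _ _ ij; rewrite -preimage_setI.
  by move/trivIsetP : tF => /(_ _ _ _ _ ij) ->//; rewrite preimage_set0.
- by rewrite -preimage_bigcup; exact: mcons.
Qed.

HB.instance Definition _ := isMeasure.Build _ _ _ lebesgue_rV_step
  step0 step_ge0 step_sigma_additive.

Let step_sigma_finite : sigma_finite setT lebesgue_rV_step.
Proof.
have /sigma_finiteP[F [TF ndF Foo]] := sigma_finiteT (@lebesgue_measure R).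
have /sigma_finiteP[G [TG ndG Goo]] := sigma_finiteT m.
exists (fun k => @rV_uncons n @^-1` (F k `*` G k)).
  rewrite predeqE => x; split=> // _.
  have [i _ Fi] : (\bigcup_i F i) (rV_uncons x).1 by rewrite -TF.
  have [j _ Gj] : (\bigcup_j G j) (rV_uncons x).2 by rewrite -TG.
  exists (maxn i j) => //; split.
    by move: (_.1) Fi; exact/subsetPset/ndF/leq_maxl.
  by move: (_.2) Gj; exact/subsetPset/ndG/leq_maxr.
move=> k; have [mF Fk] := Foo k; have [mG Gk] := Goo k; split.
  rewrite -[X in measurable X]setTI.
  by apply: measurable_rV_uncons => //; exact: measurableX.
rewrite /lebesgue_rV_step /pushforward -comp_preimage.
rewrite (_ : _ \o _ = id); last by apply/funext => p; exact: rV_consK.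
by rewrite preimage_id product_measure1E// lte_mul_pinfty// ge0_fin_numE.
Qed.

HB.instance Definition _ := Measure_isSigmaFinite.Build _ _ _ lebesgue_rV_step
  step_sigma_finite.

End step.

(* n-fold product of the one-dimensional Lebesgue measure; a Dirac mass when
   n = 0. *)
Fixpoint lebesgue_rV n : {sigma_finite_measure set 'rV[R]_n -> \bar R} :=
  match n with
  | 0 => dirac (0 : 'rV[R]_0)
  | n'.+1 => lebesgue_rV_step (lebesgue_rV n')
  end.

End lebesgue_rV.

Notation leb := (lebesgue_rV _).

Section sobolev.
Context {R : realType} {n : nat}.
Implicit Types (Omega : set 'rV[R]_n) (u v g phi : 'rV[R]_n -> R) (i : 'I_n).

Definition dot (x y : 'rV[R]_n) : R := \sum_i x 0 i * y 0 i.

(* L_p(Omega); functions live on R^n, their values off Omega are irrelevant. *)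
Definition in_L Omega (p : \bar R) v : Prop := v \_ Omega \in Lfun leb p.

Definition partial i v : 'rV[R]_n -> R := fun x => 'D_(delta_mx 0 i) v x.

Definition smooth v : Prop := forall s : seq 'I_n,
  continuous (foldr partial v s) /\
  forall i x, derivable (foldr partial v s) x (delta_mx 0 i).

(* C_c^oo(Omega) *)
Definition test_function Omega phi : Prop :=
  smooth phi /\ exists K : set 'rV[R]_n,
    [/\ compact K, K `<=` Omega & forall x, ~ K x -> phi x = 0].

Definition weak_partial_spec Omega i v g : Prop :=
  in_L Omega 2%:E g /\ forall phi, test_function Omega phi ->
    \int[leb]_(x in Omega) (v x * partial i phi x) =
    - (\int[leb]_(x in Omega) (g x * phi x)).

(* The weak derivative of v in L_2(Omega), unique up to null sets; 0 if there is
   none. *)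
Definition weak_partial Omega i v : 'rV[R]_n -> R :=
  xget (fun=> 0) [set g | weak_partial_spec Omega i v g].

Definition in_H1 Omega v : Prop :=
  in_L Omega 2%:E v /\ forall i, exists g, weak_partial_spec Omega i v g.

Definition H1_normsq Omega v : R :=
  \int[leb]_(x in Omega) (v x ^+ 2) +
  \sum_i \int[leb]_(x in Omega) (weak_partial Omega i v x ^+ 2).

(* The closure of C_c^oo(Omega) in H^1(Omega). *)
Definition in_H10 Omega v : Prop :=
  in_H1 Omega v /\ forall eps : R, 0 < eps ->
    exists2 phi, test_function Omega phi & H1_normsq Omega (v \- phi) < eps.

Definition boundary Omega : set 'rV[R]_n := closure Omega `\` interior Omega.

(* Near each boundary point, Omega is the strict epigraph, in the unit direction
   e, of a Lipschitz function h of the coordinates orthogonal to e. *)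
Definition lipschitz_boundary Omega : Prop :=
  forall x, boundary Omega x -> exists (e : 'rV[R]_n) (h : 'rV[R]_n -> R),
    [/\ dot e e = 1,
        exists L : R, forall y z, `|h y - h z| <= L * `|y - z|,
        forall y t, h (y + t *: e) = h y &
        \forall y \near x, Omega y <-> h y < dot y e].

(* nu is the outward unit normal to Omega at x: the directions entering Omega
   and those leaving it are separated by the hyperplane orthogonal to nu. *)
Definition is_outward_normal Omega (x nu : 'rV[R]_n) : Prop :=
  [/\ dot nu nu = 1,
      forall w, dot w nu < 0 -> \forall t \near 0^'+, Omega (x + t *: w) &
      forall w, 0 < dot w nu ->
        \forall t \near 0^'+, ~ closure Omega (x + t *: w)].

Definition lincomb N (Phi : 'I_N -> 'rV[R]_n -> R) (c : 'cV[R]_N) :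
  'rV[R]_n -> R := fun x => \sum_j c j 0 * Phi j x.

(* Phi is a basis of the space S of functions modulo equality a.e. in Omega. *)
Definition is_basis Omega (S : set ('rV[R]_n -> R)) N
    (Phi : 'I_N -> 'rV[R]_n -> R) : Prop :=
  [/\ forall j, S (Phi j),
      forall c, lincomb Phi c = cst 0 %[ae leb in Omega] -> c = 0 &
      forall v, S v -> exists c, v = lincomb Phi c %[ae leb in Omega]].

Definition coef_matrix_hyp Omega (A : 'rV[R]_n -> 'M[R]_n) : Prop :=
  [/\ forall a b, in_L Omega +oo%E (fun x => A x a b),
      {ae leb, forall x, Omega x -> (A x)^T = A x},
      {ae leb, forall x, Omega x ->
         forall xi : 'rV[R]_n, xi != 0 -> 0 < dot (xi *m A x) xi} &
      exists2 gamma : R, 0 < gamma &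
        {ae leb, forall x, Omega x ->
           forall xi : 'rV[R]_n, gamma * dot xi xi <= dot (xi *m A x) xi}].

End sobolev.

Section simplices.
Context {R : realType} {m n : nat}.
(* A simplex in R^n is given by the matrix of its m vertices, one per row. *)
Implicit Type T : 'M[R]_(m, n).

Definition nondegenerate T : bool := row_free (row_mx T (const_mx 1 : 'cV_m)).

Definition open_simplex T : set 'rV[R]_n :=
  [set x | exists l : 'rV[R]_m,
     [/\ forall i, 0 < l 0 i, \sum_i l 0 i = 1 & x = l *m T]].

(* Closed subsimplex on the vertices in S; empty when S is. *)
Definition subsimplex T (S : {set 'I_m}) : set 'rV[R]_n :=
  [set x | exists l : 'rV[R]_m,
     [/\ forall i, 0 <= l 0 i, \sum_i l 0 i = 1,
         forall i, i \notin S -> l 0 i = 0 & x = l *m T]].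

End simplices.

(* Integral over a d-dimensional simplex F of R^n, parametrised by the open
   reference simplex; facet_edges F has the vectors F_j - F_0 as rows. *)
Section facet_integral.
Context {R : realType} {d n : nat}.

Definition ref_simplex : set 'rV[R]_d :=
  [set t | (forall j, 0 < t 0 j) /\ \sum_j t 0 j < 1].

Definition facet_edges (F : 'M[R]_(d.+1, n)) : 'M[R]_(d, n) :=
  \matrix_(j, a) (F (lift ord0 j) a - F ord0 a).

Definition facet_point (F : 'M[R]_(d.+1, n)) (t : 'rV[R]_d) : 'rV[R]_n :=
  row ord0 F + t *m facet_edges F.

Definition facet_integral (F : 'M[R]_(d.+1, n)) (g : 'rV[R]_n -> R) : R :=
  Num.sqrt (\det (facet_edges F *m (facet_edges F)^T)) *
  \int[leb]_(t in ref_simplex) g (facet_point F t).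

End facet_integral.

(* The space dimension is d.+1, so that facets have dimension d. *)
Section finite_elements.
Context {R : realType} {d nT : nat}.
Variables (Omega : set 'rV[R]_d.+1) (T : 'I_nT -> 'M[R]_(d.+2, d.+1)).
Variables (p : nat) (n : 'rV[R]_d.+1 -> 'rV[R]_d.+1).
Implicit Types (k : 'I_nT) (i : 'I_d.+2) (a b : 'I_d.+1).
Implicit Types (V Phi Psi : 'rV[R]_d.+1 -> R).

Definition conforming_triangulation : Prop :=
  [/\ forall k, nondegenerate (T k),
      injective (fun k => open_simplex (T k)),
      forall k l, exists S S',
        let I := closure (open_simplex (T k)) `&` closure (open_simplex (T l)) in
        I = subsimplex (T k) S /\ I = subsimplex (T l) S' &
      \bigcup_k closure (open_simplex (T k)) = closure Omega].

(* Facet i of element k, opposite to vertex i, lies on the boundary. *)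
Definition boundary_facet k i : bool :=
  `[< subsimplex (T k) [set~ i]%SET `<=` boundary Omega >].

(* n is the outward unit normal; it exists in the relative interior of each
   boundary facet. *)
Definition outward_normal_field : Prop :=
  forall k i, boundary_facet k i -> forall t, ref_simplex t ->
    let x := facet_point (row' i (T k)) t in is_outward_normal Omega x (n x).

Definition in_FE V : Prop :=
  in_H1 Omega V /\ forall k, exists2 q : mpoly.mpoly d.+1 R,
    (mpoly.mmeasure mpoly.mdeg q <= p.+1)%N &
    forall x, open_simplex (T k) x -> V x = mpoly.meval (x 0) q.

Definition in_FE0 V : Prop := in_FE V /\ in_H10 Omega V.

(* The polynomial that V coincides with on element k; its values on the facets
   are the traces of V from that element. *)
Definition element_poly V k : mpoly.mpoly d.+1 R :=
  xget 0 [set q | forall x, open_simplex (T k) x -> V x = mpoly.meval (x 0) q].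

Definition trace V k : 'rV[R]_d.+1 -> R :=
  fun x => mpoly.meval (x 0) (element_poly V k).

Definition trace_partial a V k : 'rV[R]_d.+1 -> R :=
  fun x => mpoly.meval (x 0) (mpoly.mderiv a (element_poly V k)).

(* Surface integral over the boundary of Omega, which is the union of the
   boundary facets; g k is the integrand seen from element k. *)
Definition boundary_integral (g : 'I_nT -> 'rV[R]_d.+1 -> R) : R :=
  \sum_k \sum_(i | boundary_facet k i) facet_integral (row' i (T k)) (g k).

Definition is_FE_hessian V (H : 'rV[R]_d.+1 -> 'M[R]_d.+1) : Prop :=
  (forall a b, in_FE (fun x => H x a b)) /\
  forall Phi, in_FE Phi -> forall a b,
    \int[leb]_(x in Omega) (H x a b * Phi x) =
    - (\int[leb]_(x in Omega)
         (weak_partial Omega a V x * weak_partial Omega b Phi x))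
    + boundary_integral
        (fun k x => trace_partial a V k x * n x 0 b * trace Phi k x).

(* H[V]; unique up to null sets. *)
Definition FE_hessian V : 'rV[R]_d.+1 -> 'M[R]_d.+1 :=
  xget (fun=> 0) [set H | is_FE_hessian V H].

Variables (A : 'rV[R]_d.+1 -> 'M[R]_d.+1) (f : 'rV[R]_d.+1 -> R).

Definition NVFEM_solution (U : 'rV[R]_d.+1 -> R) : Prop :=
  in_FE0 U /\ forall Psi, in_FE0 Psi ->
    \int[leb]_(x in Omega) (\tr ((A x)^T *m FE_hessian U x) * Psi x) =
    \int[leb]_(x in Omega) (f x * Psi x).

Section matrices.
Context {N0 Nb : nat}.
Variables (Phi0 : 'I_N0 -> 'rV[R]_d.+1 -> R) (Phib : 'I_Nb -> 'rV[R]_d.+1 -> R).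

Definition full_basis (j : 'I_(N0 + Nb)) : 'rV[R]_d.+1 -> R :=
  match fintype.split j with inl j0 => Phi0 j0 | inr jb => Phib jb end.

Local Notation Phi := full_basis.

Definition matB a b : 'M[R]_(N0, N0 + Nb) :=
  \matrix_(i, j) \int[leb]_(x in Omega) (Phi0 i x * (A x a b * Phi j x)).

Definition matM : 'M[R]_(N0 + Nb) :=
  \matrix_(i, j) \int[leb]_(x in Omega) (Phi i x * Phi j x).

Definition matC a b : 'M[R]_(N0 + Nb, N0) :=
  \matrix_(i, j)
    (- (\int[leb]_(x in Omega)
          (weak_partial Omega b (Phi i) x * weak_partial Omega a (Phi0 j) x))
     + boundary_integral (fun k x =>
         trace (Phi i) k x * n x 0 b * trace_partial a (Phi0 j) k x)).

Definition matD : 'M[R]_N0 :=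
  \sum_a \sum_b matB a b *m invmx matM *m matC a b.

Definition vecf : 'cV[R]_N0 :=
  \col_i \int[leb]_(x in Omega) (f x * Phi0 i x).

End matrices.
End finite_elements.

(* Main.v *)
Require Import Defs.
From mathcomp Require Import all_boot all_order all_algebra.
From mathcomp Require mpoly.
From mathcomp Require Import all_classical all_reals all_analysis.
From mathcomp Require Import measurable_realfun ess_sup_inf ring lra.
Import (canonicals, coercions) mpoly.
Set Implicit Arguments.
Unset Strict Implicit.
Unset Printing Implicit Defensive.
Import Order.TTheory GRing.Theory Num.Theory.
Import numFieldNormedType.Exports.
Local Open Scope classical_set_scope.
Local Open Scope ring_scope.

(** Let [V] be the function of coefficient vector [u]. Write an entry of its finite
    element Hessian as a combination of the basis [Phi] of the full space. Testing
    the weak form with the members of [Phi] turns it into the linear system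
    [M c = C_(a,b) u], and [M] is invertible because it is the Gram matrix of a
    basis: hence [c = M^-1 C_(a,b) u] ([FE_hessian_lincomb]). Testing [A : H[V]]
    with the members of [Phi0] then produces the vector [D u] ([matD_lincomb]), so
    that the discrete problem, tested with a basis of the space with zero boundary
    values, is the system [D u = f] ([NVFEM_lincomb]).

    What takes work is that the two sides of the weak form are bilinear and do not
    depend on the representatives of the functions modulo null sets.

    Weak derivatives and discrete Hessians are picked by a choice operator. Linearity
    of the former up to null sets is their uniqueness, that is, the fundamental
    lemma of the calculus of variations ([du_bois_reymond]), proved with smooth bumps
    that are products of functions [exp (- 1 / (k t))]. The space H^1_0 is defined
    by approximation in the H^1 norm by test functions. That it is a vector space
    also uses that classical derivatives of test functions are weak derivatives
    ([test_weak_partial]), an integration by parts that follows from Fubini's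
    theorem and the fundamental theorem of calculus ([integral_partial0]).

    Traces from an element are values of a polynomial that is only known to agree
    with the given function on the element. A polynomial that vanishes almost
    everywhere on a nonempty open set vanishes everywhere, and so do its derivatives
    ([mpoly_eq0_open], [mpoly_ae0_open]): traces are well defined, linear, and
    insensitive to null sets.

    Finally, linearity of the boundary integral needs integrands that are integrable
    over the facets, although the normal field is given pointwise. The outward
    normal is determined by the facet, because the element lies on one side of it:
    the field is constant on each facet ([normal_facet_cst]), so the integrands
    coincide with polynomials. *)

(** * Boxes and open sets *)

Section boxes.
Context {R : realType}.
Implicit Types n : nat.

Definition box n (a b : 'rV[R]_n) : set 'rV[R]_n :=
  [set x | forall i, a 0 i < x 0 i < b 0 i].

Definition closed_box n (a b : 'rV[R]_n) : set 'rV[R]_n :=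
  [set x | forall i, a 0 i <= x 0 i <= b 0 i].

Lemma measurable_box n (a b : 'rV[R]_n) : measurable (box a b).
Proof.
have -> : box a b =
    \bigcap_(i in [set: 'I_n]) ((fun x => x 0 i) @^-1` `]a 0 i, b 0 i[).
  apply/seteqP; split=> x /= h i; first by move=> _; rewrite /= in_itv /= h.
  by have := h i I; rewrite /= in_itv.
apply: fin_bigcap_measurable => // i _.
by rewrite -[X in measurable X]setTI; apply: measurable_coord.
Qed.

Lemma coord_le_norm n (x : 'rV[R]_n) i : `|x 0 i| <= `|x|.
Proof.
rewrite [leRHS]/Num.Def.normr /= mx_normrE.
exact: (le_bigmax _ (fun k => `|x k.1 k.2|) (0, i)).
Qed.

Lemma rV_ballP n (x y : 'rV[R]_n) (e : R) : 0 < e ->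
  ball x e y <-> forall i, `|x 0 i - y 0 i| < e.
Proof.
move=> e0; split=> [[_ h] i|h]; first exact: h.
by split=> // i j; rewrite ord1; exact: h.
Qed.

(** For [c = (q, k)], the corners of the cube of centre [q] and half-width
    [1 / (k + 1)] are [rat_box c (-1)] and [rat_box c 1]: there are countably
    many of them. *)
Definition rat_box n (c : 'rV[rat]_n * nat) (s : R) : 'rV[R]_n :=
  \row_i (ratr (c.1 0 i) + s * c.2.+1%:R^-1).

(** The closed cubes are required to lie in [U] so that smooth functions supported
    in them are test functions on [U]. *)
Lemma open_bigcup_box n (U : set 'rV[R]_n) : open U ->
  U = \bigcup_(c in [set c : 'rV[rat]_n * nat |
         closed_box (rat_box c (-1)) (rat_box c 1) `<=` U])
      box (rat_box c (-1)) (rat_box c 1).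
Proof.
move=> oU; apply/seteqP; split; last first.
  move=> x [c /= cU bx]; apply: cU => i.
  by have /andP[h1 h2] := bx i; rewrite !ltW.
move=> x Ux; have /nbhs_ballP[e /= e0 xeU] := open_nbhs_nbhs (conj oU Ux).
have [k ke] : exists k : nat, k.+1%:R^-1 < e / 2.
  have e2 : 0 < e / 2 by rewrite divr_gt0.
  have [k _ /(_ k (leqnn k)) /= hk] := near_infty_natSinv_lt (PosNum e2).
  by exists k.
have k0 : 0 < k.+1%:R^-1 :> R by rewrite invr_gt0.
have q_ i : exists q : rat, `|x 0 i - ratr q| < k.+1%:R^-1.
  have : x 0 i < x 0 i + k.+1%:R^-1 by rewrite ltrDl.
  move=> /rat_in_itvoo[q]; rewrite in_itv /= => /andP[h1 h2]; exists q.
  by rewrite distrC ger0_norm ?subr_ge0 ?(ltW h1)// ltrBlDl.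
have [q hq] := choice q_.
exists (\row_i q i, k) => /=; last first.
  move=> i; rewrite !mxE /= mulN1r mul1r.
  by have := hq i; rewrite ltr_distl.
move=> y yq; apply: xeU; apply/(rV_ballP _ _ e0) => i.
have := yq i; rewrite !mxE /= mulN1r mul1r => /andP[h1 h2].
have := hq i; rewrite !ltr_distl => /andP[h3 h4].
move: (ratr (q i) : R) (k.+1%:R^-1 : R) (y 0 i) (x 0 i) ke h1 h2 h3 h4.
by clear => *; apply/andP; split; lra.
Qed.

Lemma open_measurable_rV n (U : set 'rV[R]_n) : open U -> measurable U.
Proof.
move=> /open_bigcup_box ->; rewrite bigcup_mkcond.
apply: countable_bigcupT_measurable => // c.
by case: ifP => _ //; exact: measurable_box.
Qed.

Lemma continuous_measurable_rV n (f : 'rV[R]_n -> R) :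
  continuous f -> measurable_fun setT f.
Proof.
move=> /continuousP cf.
apply: (measurability _ (RGenOpens.measurableE R)).
move=> _ [_ [a [b ->] <-]]; rewrite setTI.
apply: open_measurable_rV; apply: cf; exact: interval_open.
Qed.

Lemma box_cons_preimage n (a b : 'rV[R]_n.+1) :
  @rV_cons R n @^-1` box a b =
  `]a 0 ord0, b 0 ord0[%classic `*`
    box (\row_j a 0 (lift ord0 j)) (\row_j b 0 (lift ord0 j)).
Proof.
apply/seteqP; split=> -[x v] /=.
  move=> h; split=> /=.
    by have := h ord0; rewrite mxE unlift_none /= in_itv.
  by move=> j; have := h (lift ord0 j); rewrite !mxE liftK.
move=> [/= h0 h] i; rewrite mxE; case: unliftP => [j|] -> /=.
  by have := h j; rewrite !mxE.
by move: h0; rewrite in_itv.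
Qed.

Lemma lebesgue_rV_boxS n (a b : 'rV[R]_n.+1) :
  lebesgue_rV n.+1 (box a b) =
  (lebesgue_measure `](a 0 ord0)%R, (b 0 ord0)%R[%classic *
   lebesgue_rV n (box (\row_j a 0 (lift ord0 j)) (\row_j b 0 (lift ord0 j)))%R)%E.
Proof.
rewrite /= /lebesgue_rV_step /pushforward box_cons_preimage product_measure1E//.
exact: measurable_box.
Qed.

Lemma lebesgue_rV_box_fin n (a b : 'rV[R]_n) :
  (lebesgue_rV n (box a b) < +oo)%E.
Proof.
elim: n a b => [|n IH] a b.
  by rewrite /= diracE; case: (_ \in _) => /=; rewrite ltry.
rewrite lebesgue_rV_boxS; apply: lte_mul_pinfty => //.
rewrite ge0_fin_numE// lebesgue_measure_itv /=.
by case: ifP => _; rewrite -?EFinB ltry.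
Qed.

Lemma lebesgue_rV_box_gt0 n (a b : 'rV[R]_n) :
  (forall i, a 0 i < b 0 i) -> (0 < lebesgue_rV n (box a b))%E.
Proof.
elim: n a b => [|n IH] a b ab.
  by rewrite /= diracE mem_set ?lte01//= => -[].
rewrite lebesgue_rV_boxS mule_gt0//; last by apply: IH => i; rewrite !mxE.
by rewrite lebesgue_measure_itv /= lte_fin ab -EFinB lte_fin subr_gt0 ab.
Qed.

Lemma bounded_lebesgue_rV_fin n (D : set 'rV[R]_n) :
  measurable D -> bounded_set D -> (lebesgue_rV n D < +oo)%E.
Proof.
move=> mD [M [_ DM]].
have {}DM x : D x -> `|x| <= `|M| + 1.
  by apply: DM; rewrite (le_lt_trans (ler_norm M))// ltrDl.
pose c : R := `|M| + 2.
apply: le_lt_trans (lebesgue_rV_box_fin (const_mx (- c)) (const_mx c)).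
apply: le_measure; rewrite ?inE//; first exact: measurable_box.
move=> x /DM xM i; rewrite !mxE -ltr_norml.
by have := coord_le_norm x i; rewrite /c; lra.
Qed.

Lemma open_lebesgue_rV_gt0 n (U : set 'rV[R]_n) :
  open U -> U !=set0 -> (0 < lebesgue_rV n U)%E.
Proof.
move=> oU [x Ux]; move: (Ux); rewrite {1}(open_bigcup_box oU).
move=> [c /= cU _].
apply: (@lt_le_trans _ _ (lebesgue_rV n (box (rat_box c (-1)) (rat_box c 1)))).
  apply: lebesgue_rV_box_gt0 => i; rewrite !mxE ltrD2l mulN1r mul1r.
  by rewrite -subr_gt0 opprK addr_gt0 ?invr_gt0.
apply: le_measure; rewrite ?inE//; first exact: measurable_box.
  exact: open_measurable_rV.
by move=> y yb; apply: cU => i; have /andP[h1 h2] := yb i; rewrite !ltW.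
Qed.

End boxes.

(** * The space L_2 *)

Section L2.
Context {R : realType} {n : nat}.
Variable D : set 'rV[R]_n.
Hypothesis mD : measurable D.
Implicit Types f g h : 'rV[R]_n -> R.
Local Notation mu := (lebesgue_rV n).

Lemma in_L_measurable p f : in_L D p f -> measurable_fun D f.
Proof.
rewrite /in_L inE => /andP[+ _]; rewrite inE /= => mf.
exact/(measurable_restrictT f mD).
Qed.

Lemma in_L2P f : in_L D 2%:E f <->
  measurable_fun D f /\ mu.-integrable D (EFin \o (fun x => f x ^+ 2)).
Proof.
split=> [Lf|[mf If]].
  split; first exact: in_L_measurable Lf.
  have := Lfun2_integrable_sqr Lf.
  rewrite (integrable_mkcond _ mD) restrict_EFin.
  congr (_.-integrable _ _); apply/funext => x /=; congr EFin.
  by rewrite /patch; case: ifP => // _; rewrite expr0n.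
rewrite /in_L inE; apply/andP; split; rewrite inE /=.
  exact/(measurable_restrictT f mD).
rewrite /finite_norm unlock /Lnorm poweR_lty//.
move: If; rewrite (integrable_mkcond _ mD) restrict_EFin => /integrableP[_].
apply: le_lt_trans; rewrite le_eqVlt; apply/orP; left; apply/eqP.
apply: eq_integral => x _ /=; rewrite powR_mulrn// -normrX; congr (_%:E).
by congr (`|_|); rewrite /patch; case: ifP => // _; rewrite expr0n.
Qed.

Lemma in_L2D f g : in_L D 2%:E f -> in_L D 2%:E g ->
  in_L D 2%:E (fun x => f x + g x).
Proof.
move=> Lf Lg; rewrite /in_L.
have -> : (fun x => f x + g x) \_ D = 1 *: (f \_ D) + g \_ D :> (_ -> R).
  by apply/funext => x; rewrite !fctE scale1r /patch; case: ifP; rewrite ?addr0.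
by have [_] := Lfun_submod_closed mu (@lee1n R 2); apply.
Qed.

Lemma in_L20 : in_L D 2%:E (fun=> 0).
Proof.
rewrite /in_L; have -> : (fun=> 0) \_ D = 0 :> (_ -> R).
  by apply/funext => x; rewrite /patch; case: ifP.
by have [] := Lfun_submod_closed mu (@lee1n R 2).
Qed.

Lemma in_L2Z c f : in_L D 2%:E f -> in_L D 2%:E (fun x => c * f x).
Proof.
move=> Lf; rewrite /in_L.
have -> : (fun x => c * f x) \_ D = c *: (f \_ D) + 0 :> (_ -> R).
  apply/funext => x; rewrite !fctE addr0 /patch.
  by case: ifP => // _; rewrite scaler0.
have [L0] := Lfun_submod_closed mu (@lee1n R 2); apply => //.
Qed.

Lemma in_L2B f g : in_L D 2%:E f -> in_L D 2%:E g ->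
  in_L D 2%:E (fun x => f x - g x).
Proof.
move=> Lf Lg; have -> : (fun x => f x - g x) = (fun x => f x + -1 * g x).
  by apply/funext => x; rewrite mulN1r.
by apply: in_L2D => //; exact: in_L2Z.
Qed.

Lemma in_L2_sum (I : Type) (r : seq I) (F : I -> 'rV[R]_n -> R) :
  (forall i, in_L D 2%:E (F i)) -> in_L D 2%:E (fun x => \sum_(i <- r) F i x).
Proof.
move=> LF; elim: r => [|i r IH].
  by under eq_fun do rewrite big_nil; exact: in_L20.
by under eq_fun do rewrite big_cons; exact: in_L2D.
Qed.

Lemma L2M_integrable f g : in_L D 2%:E f -> in_L D 2%:E g ->
  mu.-integrable D (EFin \o (fun x => f x * g x)).
Proof.
move=> Lf Lg; have /Lfun1_integrable := Lfun2_mul_Lfun1 Lf Lg.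
rewrite (integrable_mkcond _ mD) restrict_EFin.
congr (_.-integrable _ _); apply/funext => x /=; congr EFin.
by rewrite /patch; case: ifP => // _; rewrite mulr0.
Qed.

Lemma bounded_in_L2 f (M : R) : (mu D < +oo)%E -> measurable_fun D f ->
  (forall x, D x -> `|f x| <= M) -> in_L D 2%:E f.
Proof.
move=> Dfin mf fM; apply/in_L2P; split=> //.
apply: measurable_bounded_integrable => //; first exact: measurable_funX.
exists (M ^+ 2); split; first exact: num_real.
move=> y My x Dx; rewrite /= (le_trans _ (ltW My))// normrX.
by rewrite lerXn2r ?nnegrE ?fM// (le_trans _ (fM x Dx)).
Qed.

(** The essential bound on [a] is only available where the whole space is not
    null, whence the case distinction. *)
Lemma in_Loo_mul_L2 a f : in_L D +oo%E a -> in_L D 2%:E f ->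
  in_L D 2%:E (fun x => a x * f x).
Proof.
move=> La Lf; have ma := in_L_measurable La.
have [mf If] := (in_L2P f).1 Lf.
have maf : measurable_fun D (fun x => a x * f x) by exact: measurable_funM.
apply/in_L2P; split=> //.
have [mu0|mu0] := eqVneq (mu [set: _]) (0%E : \bar R).
  have D0 : mu D = 0%E.
    by apply/eqP; rewrite -measure_le0 -mu0 le_measure// inE.
  apply: null_set_integrable => //; apply/measurable_EFinP.
  exact: measurable_funX.
have [M hM] : exists M, {ae mu, forall x, D x -> `|a x| <= M}.
  move: La; rewrite /in_L inE => /andP[_].
  rewrite inE /= /finite_norm unlock /Lnorm.
  rewrite lt0e mu0 measure_ge0 /=.
  move=> /ess_supr_bounded [M hM]; exists M.
  by apply: filterS hM => x /= + Dx; rewrite /patch mem_set.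
have mM : measurable_fun D (EFin \o (fun x => (a x * f x) ^+ 2)).
  by apply/measurable_EFinP; exact: measurable_funX.
apply/integrableP; split=> //.
have /integrableP[_] : mu.-integrable D (EFin \o (fun x => M ^+ 2 * f x ^+ 2)).
  by apply: (eq_integrable mD _ _ _ (integrableZl mD (M ^+ 2) If)).
apply: le_lt_trans; apply: ae_ge0_le_integral => //.
- exact: measurableT_comp.
- apply: measurableT_comp => //; apply/measurable_EFinP.
  by apply: measurable_funM => //; exact: measurable_funX.
apply: filterS hM => x /= aM Dx.
rewrite lee_fin exprMn normrM [leRHS]normrM ler_wpM2r//.
rewrite !normrX lerXn2r ?nnegrE// (le_trans (aM Dx))//.
exact: ler_norm.
Qed.

Lemma ae_eq_Rintegral f g : measurable_fun D f -> measurable_fun D g ->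
  f = g %[ae mu in D] ->
  \int[mu]_(x in D) f x = \int[mu]_(x in D) g x.
Proof.
move=> mf mg fg; congr fine; apply: ae_eq_integral => //.
- exact/measurable_EFinP.
- exact/measurable_EFinP.
- by apply: filterS fg => x /= + Dx => ->.
Qed.

Definition inner f g : R := \int[mu]_(x in D) (f x * g x).

Lemma innerC f g : inner f g = inner g f.
Proof. by apply: eq_Rintegral => x _; rewrite mulrC. Qed.

Lemma innerDl f g h : in_L D 2%:E f -> in_L D 2%:E g -> in_L D 2%:E h ->
  inner (fun x => f x + g x) h = inner f h + inner g h.
Proof.
move=> Lf Lg Lh; rewrite /inner -RintegralD//; try exact: L2M_integrable.
by apply: eq_Rintegral => x _; rewrite mulrDl.
Qed.

Lemma innerZl c f h : in_L D 2%:E f -> in_L D 2%:E h ->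
  inner (fun x => c * f x) h = c * inner f h.
Proof.
move=> Lf Lh; rewrite /inner -RintegralZl//; try exact: L2M_integrable.
by apply: eq_Rintegral => x _; rewrite mulrA.
Qed.

Lemma innerBl f g h : in_L D 2%:E f -> in_L D 2%:E g -> in_L D 2%:E h ->
  inner (fun x => f x - g x) h = inner f h - inner g h.
Proof.
move=> Lf Lg Lh; rewrite /inner -RintegralB//; try exact: L2M_integrable.
by apply: eq_Rintegral => x _; rewrite mulrBl.
Qed.

Lemma inner0l h : inner (fun=> 0) h = 0.
Proof.
rewrite /inner; under eq_Rintegral do rewrite mul0r.
by rewrite Rintegral_cst// mul0r.
Qed.

Lemma inner_suml (I : Type) (r : seq I) (F : I -> 'rV[R]_n -> R) h :
  (forall i, in_L D 2%:E (F i)) -> in_L D 2%:E h ->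
  inner (fun x => \sum_(i <- r) F i x) h = \sum_(i <- r) inner (F i) h.
Proof.
move=> LF Lh; elim: r => [|i r IH].
  by rewrite big_nil; under eq_fun do rewrite big_nil; exact: inner0l.
rewrite big_cons -IH -innerDl//; last exact: in_L2_sum.
by congr inner; apply/funext => x; rewrite big_cons.
Qed.

Lemma inner_ae_l f g h : in_L D 2%:E f -> in_L D 2%:E g -> in_L D 2%:E h ->
  f = g %[ae mu in D] -> inner f h = inner g h.
Proof.
move=> Lf Lg Lh fg; apply: ae_eq_Rintegral.
- by apply: measurable_funM; [exact: in_L_measurable Lf|exact: in_L_measurable Lh].
- by apply: measurable_funM; [exact: in_L_measurable Lg|exact: in_L_measurable Lh].
- by apply: filterS fg => x /= + Dx => ->.
Qed.

Lemma inner_eq0 f : in_L D 2%:E f -> inner f f = 0 -> f = cst 0 %[ae mu in D].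
Proof.
move=> Lf; have Iff := L2M_integrable Lf Lf.
rewrite /inner /Rintegral => f0.
have {}f0 : (\int[mu]_(x in D) (f x * f x)%:E = 0)%E.
  by rewrite -[LHS]fineK ?f0//; exact: integrable_fin_num.
have [+ _] := ae_eq_integral_abs mu mD (measurable_int _ Iff).
under eq_integral do rewrite /= ger0_norm -?expr2 ?sqr_ge0// expr2.
move=> /(_ f0); apply: filterS => x /= h Dx.
by have [/eqP] := h Dx; rewrite mulf_eq0 orbb => /eqP.
Qed.

Lemma inner_ge0 f : 0 <= inner f f.
Proof. by apply: Rintegral_ge0 => x _; rewrite -expr2 sqr_ge0. Qed.

End L2.

(** * Flat functions and smooth bumps *)

Section flat_function.
Context {R : realType}.
Implicit Types q : {poly R}.

(** The family of these functions, [q] ranging over the polynomials, is stable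
    under differentiation, which makes the classical function
    [exp (- 1 / x)] smooth at 0. *)
Definition flat q (x : R) : R :=
  if 0 < x then q.[x^-1] * expR (- x^-1) else 0.

(** The polynomial [q~] such that [flat q~] is the derivative of [flat q]. *)
Definition flat_deriv q : {poly R} := 'X^2 * (q - q^`()).

(** One term of the exponential series dominates the given power. *)
Lemma expr_expRN_le (t : R) i : 0 < t -> t ^+ i * expR (- t) <= i.+1`!%:R * t^-1.
Proof.
move=> t0; have := expR_ge1Dxn i (ltW t0).
rewrite expRN ler_pdivrMr ?expR_gt0// => h.
have {h} : t ^+ i.+1 / i.+1`!%:R <= expR t by rewrite (le_trans _ h)// lerDr.
rewrite ler_pdivrMr ?ltr0n ?fact_gt0// exprS => h.
by rewrite mulrAC ler_pdivlMr// mulrC [leRHS]mulrC.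
Qed.

(** Applied to [X q], this makes the difference quotient of [flat q] at 0 vanish
    in the limit. *)
Lemma flat_le q : exists2 C : R, 0 <= C & forall x, `|flat q x| <= C * `|x|.
Proof.
exists (\sum_(i < size q) `|q`_i| * i.+1`!%:R).
  by apply: sumr_ge0 => i _; rewrite mulr_ge0.
move=> x; rewrite /flat; case: ifPn => x0; last first.
  rewrite normr0 mulr_ge0//; apply: sumr_ge0 => i _; by rewrite mulr_ge0.
have t0 : 0 < x^-1 by rewrite invr_gt0.
rewrite horner_coef mulr_suml mulr_suml (le_trans (ler_norm_sum _ _ _))//.
apply: ler_sum => i _; rewrite -!mulrA normrM ler_wpM2l//.
rewrite ger0_norm ?mulr_ge0 ?exprn_ge0 ?expR_ge0 ?(ltW t0)//.
by rewrite (le_trans (expr_expRN_le _ t0))// invrK gtr0_norm.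
Qed.

Lemma flat_derive q (x : R) : is_derive x 1 (flat q) (flat (flat_deriv q) x).
Proof.
have [x0|x0|->] := ltgtP x 0.
- have -> : flat (flat_deriv q) x = 0 by rewrite /flat ltNge ltW.
  apply: (@near_eq_is_derive _ _ _ (cst (0 : R))).
  near=> y; rewrite /flat ltNge ltW//=; near: y.
  exact: lt_nbhsl.
- have xn0 : x != 0 by rewrite gt_eqF.
  apply: (@near_eq_is_derive _ _ _
    ((horner q \o GRing.inv) * (expR \o (fun y => - y^-1)))).
    near=> y; rewrite /flat !fctE ifT//=; near: y.
    exact: lt_nbhsr.
  have dq : is_derive x^-1 1 (horner q) (q^`().[x^-1]).
    by rewrite derivE derive1E; apply/derivableP/derivable_horner.
  have dinv : is_derive x 1 (GRing.inv : R -> R) (- x ^- 2).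
    have := @is_deriveV R id x 1 1 xn0 (is_derive_id _ _).
    by rewrite /GRing.scale /= mulr1.
  have d1 := is_derive1_comp dq dinv.
  have dN : is_derive x 1 (fun y : R => - y^-1) (- - x ^- 2).
    exact: (is_deriveN dinv).
  have d2 := @is_derive1_comp _ expR (fun y : R => - y^-1) x _ _
    (is_derive_expR _) dN.
  refine (eq_ind _ (fun z => is_derive x 1 _ z) (is_deriveM d1 d2) _ _).
  rewrite /flat x0 /flat_deriv !hornerE /= /GRing.scale /= exprVn.
  by rewrite opprK; ring.
- have -> : flat (flat_deriv q) 0 = 0 by rewrite /flat ltxx.
  have [C C0 hC] := flat_le ('X * q).
  suff h : (fun h => h^-1 *: ((flat q \o shift 0) (h *: (1 : R)) - flat q 0))
      @ 0^' --> (0 : R).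
    apply: DeriveDef; first by apply/cvg_ex; exists (0 : R); exact: h.
    by apply: cvg_lim => //; exact: h.
  have h0 : (fun h : R => C * `|h|) @ 0^' --> (0 : R).
    rewrite -[X in _ --> X](mulr0 C); apply: cvgMr.
    apply: cvg_within_filter; have := @norm_continuous _ R (0 : R).
    by rewrite /continuous_at /= normr0.
  apply/cvgr0Pnorm_le => e e0.
  have /cvgr0Pnorm_le/(_ _ e0) := h0; apply: filterS => h /= he.
  rewrite /shift /= addr0 [h *: 1]mulr1.
  have -> : flat q 0 = 0 by rewrite /flat ltxx.
  rewrite subr0 (le_trans _ he)// (le_trans _ (ler_norm _))//.
  apply: le_trans (hC h); rewrite /flat; case: ifPn => _.
    by rewrite !hornerE -mulrA.
  by rewrite scaler0.
Unshelve. all: by end_near. Qed.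

Lemma flat_continuous q : continuous (flat q).
Proof.
move=> x; apply: differentiable_continuous; apply/derivable1_diffP.
by have [] := flat_derive q x.
Qed.

End flat_function.

Section smooth_bumps.
Context {R : realType} {n : nat}.
Implicit Types (f g phi : 'rV[R]_n -> R) (x v a b : 'rV[R]_n) (i j : 'I_n).

Lemma is_derive_line f x v (df : R) :
  is_derive (0 : R) 1 (fun h : R => f (h *: v + x)) df -> is_derive x v f df.
Proof.
move=> [d dE]; apply: DeriveDef; first exact/derivable1P.
rewrite -dE /derive; set g1 := fun h => h^-1 *: _; set g2 := fun h => h^-1 *: _.
suff -> : g1 = g2 by [].
by rewrite /g1 /g2; apply/funext => h /=; rewrite addr0 scale0r add0r [h *: 1]mulr1.
Qed.

Lemma flat_coord_derive q (i : 'I_n) (c e : R) x v :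
  is_derive x v (fun y => flat q (c * y 0 i + e))
    (c * v 0 i * flat (flat_deriv q) (c * x 0 i + e)).
Proof.
apply: is_derive_line.
pose l (h : R) : R := c * (h *: v + x) 0 i + e.
have dl : is_derive (0 : R) 1 l (c * v 0 i).
  have -> : l = (c * v 0 i) *: (id : R -> R) + cst (c * x 0 i + e).
    by apply/funext => h; rewrite !fctE /l !mxE /GRing.scale /=; ring.
  have := @is_deriveD R R R _ _ _ _ _ _
    (@is_deriveZ R R R id (c * v 0 i) 0 1 1 (is_derive_id _ _))
    (is_derive_cst (c * x 0 i + e : R) (0 : R) (1 : R)).
  by rewrite addr0 [_ *: 1]mulr1.
have := @is_derive1_comp _ (flat q) l 0 _ _ (flat_derive q _) dl.
by rewrite mulrC /l scale0r add0r.
Qed.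

(** An algebra of continuous functions that is stable under all partial
    derivatives: its members are smooth without any computation of iterated
    derivatives. *)
Inductive flat_alg : ('rV[R]_n -> R) -> Prop :=
| flat_alg_cst c : flat_alg (fun=> c)
| flat_alg_flat q i c e : flat_alg (fun x => flat q (c * x 0 i + e))
| flat_algD f g : flat_alg f -> flat_alg g -> flat_alg (fun x => f x + g x)
| flat_algM f g : flat_alg f -> flat_alg g -> flat_alg (fun x => f x * g x).

Lemma affine_coord_continuous i (c e : R) :
  continuous (fun x : 'rV[R]_n => c * x 0 i + e).
Proof.
move=> x; have h : {for x, continuous (fun y : 'rV[R]_n => y 0 i)}.
  exact: coord_continuous.
have hc (z : R) : {for x, continuous (fun y : 'rV[R]_n => z)}.
  exact: cst_continuous.
exact: (continuousD (continuousM (hc c) h) (hc e)).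
Qed.

Lemma flat_alg_continuous f : flat_alg f -> continuous f.
Proof.
elim=> {f} [c|q i c e|f g _ cf _ cg|f g _ cf _ cg] x.
- exact: (@cst_continuous _ _ c x).
- apply: (@continuous_comp _ _ _ (fun x : 'rV[R]_n => c * x 0 i + e) (flat q));
    last exact: flat_continuous.
  exact: affine_coord_continuous.
- exact: (continuousD (cf x) (cg x)).
- exact: (continuousM (cf x) (cg x)).
Qed.

Lemma flat_alg_derivable f : flat_alg f -> forall x v, derivable f x v.
Proof.
elim=> {f} [c|q i c e|f g _ df _ dg|f g _ df _ dg] x v.
- exact: derivable_cst.
- by have [] := flat_coord_derive q i c e x v.
- exact: derivableD.
- exact: derivableM.
Qed.

Lemma flat_alg_partial f : flat_alg f -> forall j, flat_alg (partial j f).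
Proof.
elim=> {f} [c|q i c e|f g af df ag dg|f g af df ag dg] j.
- have -> : partial j (fun=> c) = fun=> 0.
    by apply/funext => x; exact: derive_cst.
  exact: flat_alg_cst.
- have -> : partial j (fun x => flat q (c * x 0 i + e)) =
      fun x => c * (delta_mx 0 j : 'rV[R]_n) 0 i *
        flat (flat_deriv q) (c * x 0 i + e).
    by apply/funext => x; have [] := flat_coord_derive q i c e x (delta_mx 0 j).
  by apply: flat_algM; [exact: flat_alg_cst|exact: flat_alg_flat].
- have -> : partial j (fun x => f x + g x) = fun x => partial j f x + partial j g x.
    by apply/funext => x; apply: deriveD; exact: flat_alg_derivable.
  exact: flat_algD.
- have -> : partial j (fun x => f x * g x) =
      fun x => f x * partial j g x + g x * partial j f x.
    by apply/funext => x; apply: deriveM; exact: flat_alg_derivable.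
  by apply: flat_algD; apply: flat_algM.
Qed.

Lemma flat_alg_smooth f : flat_alg f -> smooth f.
Proof.
move=> af s; have {af} : flat_alg (foldr partial f s).
  by elim: s => //= j s IH; exact: flat_alg_partial.
move=> h; split; first exact: flat_alg_continuous.
by move=> i x; exact: flat_alg_derivable.
Qed.

(** As [k] grows, these smooth functions with values in [0, 1] converge to the
    indicator function of the box, since [exp (- 1 / (k t))] tends to 1 for every
    [t > 0]. *)
Definition box_bump a b (k : nat) (x : 'rV[R]_n) : R :=
  \prod_i (flat 1 (k%:R * (x 0 i - a 0 i)) * flat 1 (k%:R * (b 0 i - x 0 i))).

Lemma flat_alg_prod (r : seq 'I_n) (F : 'I_n -> 'rV[R]_n -> R) :
  (forall i, flat_alg (F i)) -> flat_alg (fun x => \prod_(i <- r) F i x).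
Proof.
move=> aF; elim: r => [|i r IH].
  by under eq_fun do rewrite big_nil; exact: flat_alg_cst.
by under eq_fun do rewrite big_cons; exact: flat_algM.
Qed.

Lemma box_bump_flat_alg a b k : flat_alg (box_bump a b k).
Proof.
apply: flat_alg_prod => i.
have -> : (fun x : 'rV[R]_n =>
    flat 1 (k%:R * (x 0 i - a 0 i)) * flat 1 (k%:R * (b 0 i - x 0 i))) =
  (fun x => flat 1 (k%:R * x 0 i + (- k%:R * a 0 i)) *
            flat 1 (- k%:R * x 0 i + k%:R * b 0 i)).
  by apply/funext => x; congr (flat _ _ * flat _ _); ring.
by apply: flat_algM; exact: flat_alg_flat.
Qed.

Lemma flat1E (x : R) : flat 1 x = if 0 < x then expR (- x^-1) else 0.
Proof. by rewrite /flat hornerC mul1r. Qed.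

Lemma flat1_ge0 (x : R) : 0 <= flat 1 x.
Proof. by rewrite flat1E; case: ifP => // _; exact: expR_ge0. Qed.

Lemma flat1_le1 (x : R) : flat 1 x <= 1.
Proof.
rewrite flat1E; case: ifP => // x0.
by rewrite -expR0 ler_expR oppr_le0 invr_ge0 ltW.
Qed.

Lemma box_bump_ge0 a b k x : 0 <= box_bump a b k x.
Proof. by apply: prodr_ge0 => i _; rewrite mulr_ge0 ?flat1_ge0. Qed.

Lemma box_bump_le1 a b k x : box_bump a b k x <= 1.
Proof.
suff /andP[] : 0 <= box_bump a b k x <= 1 by [].
apply: (big_ind (fun z : R => 0 <= z <= 1)); first by rewrite ler01 lexx.
  by move=> y z /andP[y0 y1] /andP[z0 z1]; rewrite mulr_ge0// mulr_ile1.
by move=> i _; rewrite mulr_ge0 ?mulr_ile1 ?flat1_ge0 ?flat1_le1.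
Qed.

Lemma box_bump_out a b k x : ~ box a b x -> box_bump a b k x = 0.
Proof.
move=> /existsNP[i /negP]; rewrite /box_bump (bigD1 i)//= negb_and -!leNgt.
rewrite !flat1E => h; suff -> : forall z t : R,
  (if 0 < k%:R * (x 0 i - a 0 i) then z else 0) *
  (if 0 < k%:R * (b 0 i - x 0 i) then t else 0) = 0 by rewrite mul0r.
move=> z t; case/orP: h => h.
  by rewrite ltNge mulr_ge0_le0 ?subr_le0//= mul0r.
by rewrite [X in _ * (if X then _ else _)]ltNge mulr_ge0_le0 ?subr_le0//= mulr0.
Qed.

Lemma box_bump_in a b x : box a b x -> box_bump a b k x @[k --> \oo] --> (1 : R).
Proof.
move=> bx; have h1 (t : R) : 0 < t -> flat 1 (k%:R * t) @[k --> \oo] --> (1 : R).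
  move=> t0; rewrite -(cvg_shiftS (fun k : nat => flat 1 (k%:R * t))) /=.
  have -> : (fun k => flat 1 (k.+1%:R * t)) =
      fun k : nat => expR (- (k.+1%:R^-1 * t^-1)).
    by apply/funext => k; rewrite flat1E mulr_gt0// invfM.
  suff : (fun k : nat => expR (- (k.+1%:R^-1 * t^-1))) @ \oo -->
      expR (- (0 * t^-1)).
    by rewrite mul0r oppr0 expR0.
  apply: continuous_cvg; first exact: continuous_expR.
  by apply: cvgN; apply: cvgMl; exact: cvg_harmonic.
suff : box_bump a b k x @[k --> \oo] --> \prod_(i <- index_enum 'I_n) (1 : R).
  by rewrite big1_eq.
rewrite /box_bump; elim: (index_enum _) => [|i r IH].
  by under eq_fun do rewrite big_nil; rewrite big_nil; exact: cvg_cst.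
under eq_fun do rewrite big_cons; rewrite big_cons; apply: cvgM => //.
have /andP[ax xb] := bx i.
suff : (flat 1 (k%:R * (x 0 i - a 0 i)) * flat 1 (k%:R * (b 0 i - x 0 i)))
    @[k --> \oo] --> (1 * 1 : R) by rewrite mul1r.
by apply: cvgM; apply: h1; rewrite subr_gt0.
Qed.

End smooth_bumps.

(** * The fundamental lemma of the calculus of variations *)

Section box_sigma_algebra.
Context {R : realType} {n : nat}.
Implicit Types (a b : 'rV[R]_n).

Definition boxes : set (set 'rV[R]_n) := [set B | exists a b, B = box a b].

Lemma boxI a b a' b' : box a b `&` box a' b' =
  box (\row_i Num.max (a 0 i) (a' 0 i)) (\row_i Num.min (b 0 i) (b' 0 i)).
Proof.
apply/seteqP; split=> x.
  move=> [h h'] i; rewrite !mxE gt_max lt_min.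
  by have /andP[-> ->] := h i; have /andP[-> ->] := h' i.
move=> h; split=> i; have := h i; rewrite !mxE gt_max lt_min.
  by move=> /andP[/andP[-> _] /andP[->]].
by move=> /andP[/andP[_ ->] /andP[_ ->]].
Qed.

Lemma setI_closed_boxes : setI_closed boxes.
Proof.
move=> A B [a [b ->]] [a' [b' ->]]; rewrite boxI.
by eexists; eexists.
Qed.

Lemma measurable_boxes : measurable = <<s boxes >>.
Proof.
apply/seteqP; split; last first.
  apply: smallest_sub; first exact: sigma_algebra_measurable.
  by move=> _ [a [b ->]]; exact: measurable_box.
apply: smallest_sub; first exact: smallest_sigma_algebra.
rewrite -bigcup_seq; apply: bigcup_sub => i _ _ [Y mY <-].
have mi : measurable_fun [set: g_sigma_algebraType boxes]
    (fun x : g_sigma_algebraType boxes => (x : 'rV[R]_n) 0 i).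
  apply: (measurability _ (RGenOpens.measurableE R)).
  move=> _ [_ [c [d ->] <-]]; rewrite setTI.
  have -> : (fun x : g_sigma_algebraType boxes => (x : 'rV[R]_n) 0 i)
        @^-1` `]c, d[ = \bigcup_k box (\row_j if j == i then c else - k%:R)
                    (\row_j if j == i then d else k%:R).
    apply/seteqP; split=> x /=; last first.
      by move=> [k _ /(_ i)]; rewrite !mxE eqxx in_itv.
    rewrite in_itv /= => xi; exists (Num.bound `|x|) => // j.
    rewrite !mxE; case: eqP => [->//|_]; rewrite -ltr_norml.
    apply: le_lt_trans (archi_boundP (normr_ge0 x)).
    exact: coord_le_norm.
  apply: bigcupT_measurable => k; apply: sub_sigma_algebra.
  by eexists; eexists.
by have := mi measurableT Y mY; rewrite setTI.
Qed.

Lemma compact_closed_box a b : compact (closed_box a b).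
Proof.
have -> : closed_box a b =
    [set v : 'rV[R]_n | forall i, `[a 0 i, b 0 i]%classic (v ord0 i)].
  by apply/seteqP; split=> x /= h i; have := h i; rewrite /= in_itv.
apply: (@rV_compact _ _ (fun i => `[a 0 i, b 0 i]%classic)) => i.
exact: segment_compact.
Qed.

Lemma sub_closed_box a b : box a b `<=` closed_box a b.
Proof. by move=> x h i; have /andP[h1 h2] := h i; rewrite !ltW. Qed.

Lemma box_bump_test_function (Omega : set 'rV[R]_n) a b k :
  closed_box a b `<=` Omega -> test_function Omega (box_bump a b k).
Proof.
move=> abO; split; first exact/flat_alg_smooth/box_bump_flat_alg.
exists (closed_box a b); split=> //; first exact: compact_closed_box.
by move=> x nx; apply: box_bump_out; apply: contra_not nx; exact: sub_closed_box.
Qed.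

End box_sigma_algebra.

Section du_bois_reymond.
Context {R : realType} {n : nat}.
Implicit Types (a b : 'rV[R]_n).
Local Notation mu := (lebesgue_rV n).
Variables (Omega : set 'rV[R]_n) (h : 'rV[R]_n -> R).
Hypotheses (oOmega : open Omega) (ih : mu.-integrable Omega (EFin \o h)).
Hypothesis h0 : forall phi, test_function Omega phi ->
  \int[mu]_(x in Omega) (h x * phi x) = 0.

Let mO : measurable Omega := open_measurable_rV oOmega.

(** Dominated convergence along the smooth bumps of the box. *)
Lemma integral_box0 a b : closed_box a b `<=` Omega ->
  (\int[mu]_(x in box a b) (h x)%:E = 0)%E.
Proof.
move=> abO; have mh := measurable_int _ ih.
have mhR : measurable_fun Omega h by exact/measurable_EFinP.
have mbump k : measurable_fun Omega (box_bump a b k).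
  apply: measurable_funTS; apply: continuous_measurable_rV.
  by apply: flat_alg_continuous; exact: box_bump_flat_alg.
have bO : Omega `&` box a b = box a b.
  by rewrite setIC; apply/setIidPl => x /sub_closed_box; exact: abO.
have mb := measurable_box a b.
have mres : measurable_fun Omega (h \_ (box a b)).
  by apply/(measurable_restrict h mb mO); apply: measurable_funS mhR.
have [|||||_ _ hlim] := @dominated_convergence _ _ _ mu Omega mO
  (fun k x => (h x * box_bump a b k x)%:E) (fun x => ((h \_ (box a b)) x)%:E)
  (fun x => `|(h x)%:E|%E).
- by move=> k; apply/measurable_EFinP; exact: measurable_funM.
- exact/measurable_EFinP.
- apply: aeW => x Ox; apply: cvg_EFin; first exact: nearW.
  rewrite /patch; case: ifPn => [/set_mem bx|/negP nbx] /=.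
    rewrite -[X in _ --> X]mulr1; apply: cvgMr; exact: box_bump_in.
  apply: cvg_near_cst; apply: nearW => k /=.
  by rewrite box_bump_out ?mulr0// => bx; apply: nbx; exact: mem_set.
- exact: integrable_abse.
- apply: aeW => x k Ox; rewrite lee_fin normrM ler_piMr//.
  by rewrite ger0_norm ?box_bump_ge0 ?box_bump_le1.
have : (fun k => \int[mu]_(x in Omega) (h x * box_bump a b k x)%:E)%E @ \oo --> 0%E.
  apply: cvg_near_cst; apply: nearW => k.
  have := h0 (box_bump_test_function k abO).
  rewrite /Rintegral => e0; rewrite -[LHS]fineK ?e0//.
  apply: integrable_fin_num => //.
  apply: le_integrable ih => //.
    by apply/measurable_EFinP; exact: measurable_funM.
  move=> x Ox; rewrite lee_fin normrM ler_piMr//.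
  by rewrite ger0_norm ?box_bump_ge0 ?box_bump_le1.
move=> /(cvg_unique _ hlim) => e; rewrite -e//.
rewrite -{1}bO integral_mkcondr; apply: eq_integral => x _.
by rewrite restrict_EFin.
Qed.

(** The boxes form a pi-system that generates the sigma-algebra. *)
Lemma integral_in_box0 a b E : closed_box a b `<=` Omega -> measurable E ->
  (\int[mu]_(x in box a b `&` E) (h x)%:E = 0)%E.
Proof.
move=> abO; have mb := measurable_box a b.
have ib : mu.-integrable (box a b) (EFin \o h).
  by apply: integrableS ih => // x /sub_closed_box; exact: abO.
rewrite {1}measurable_boxes.
apply: (@dynkin_induction _ _ boxes
  (fun E => (\int[mu]_(x in box a b `&` E) (h x)%:E = 0)%E)
  measurable_boxes setI_closed_boxes) => /=.
- by rewrite setIT integral_box0.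
- move=> _ [c [d ->]]; rewrite boxI integral_box0// => x xcd; apply: abO => i.
  have := xcd i; rewrite !mxE ge_max le_min.
  by move=> /andP[/andP[-> _] /andP[->]].
- move=> S mS S0; have := integral_box0 abO.
  rewrite -{1}(setUIDK (box a b) S) integral_setU_EFin//=.
  + by rewrite S0 add0e setDE.
  + exact: measurableI.
  + exact: measurableD.
  + by rewrite setUIDK; apply/measurable_EFinP; exact: measurable_int ib.
  + apply/disj_setPS => x [[_ Sx] [_]]; exact.
- move=> F mF tF F0; rewrite setI_bigcupr integral_bigcup//.
  + by rewrite eseries0// => i _ _; exact: F0.
  + exact: trivIset_setIl.
  + by move=> k; exact: measurableI.
  + apply: integrableS ib => //.
      by apply: bigcupT_measurable => k; exact: measurableI.
    by apply: bigcup_sub => i _; exact: subIsetl.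
Qed.

(** The integral of [h] vanishes on every measurable part of each of the countably
    many rational cubes that cover [Omega]. *)
Lemma du_bois_reymond : h = cst 0 %[ae mu in Omega].
Proof.
pose I := [set c : 'rV[rat]_n * nat |
  closed_box (@rat_box R n c (-1)) (rat_box c 1) `<=` Omega].
have hI c : I c -> h = cst 0 %[ae mu in box (@rat_box R n c (-1)) (rat_box c 1)].
  move=> cI; have mb := measurable_box (@rat_box R n c (-1)) (rat_box c 1).
  have ib : mu.-integrable (box (@rat_box R n c (-1)) (rat_box c 1)) (EFin \o h).
    by apply: integrableS ih => // x /sub_closed_box; exact: cI.
  have H := @integral_ae_eq _ _ _ mu _ mb (cst 0%E) _ ib (measurable_cst _).
  have /H : forall E, E `<=` box (@rat_box R n c (-1)) (rat_box c 1) ->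
    measurable E -> (\int[mu]_(x in E) (EFin \o h) x = \int[mu]_(x in E) cst 0 x)%E.
    move=> E Eb mE; rewrite integral0 -(setIidr Eb).
    exact: integral_in_box0.
  by apply: filterS => x /= e bx; have [] := e bx.
have : {ae mu, forall x, forall c, I c ->
    box (@rat_box R n c (-1)) (rat_box c 1) x -> h x = 0}.
  have : {ae mu, forall x, forall k : nat, forall c, unpickle k = Some c -> I c ->
     box (@rat_box R n c (-1)) (rat_box c 1) x -> h x = 0}.
    apply/ae_foralln => k; case: (unpickle k) => [c|]; last exact: aeW.
    have [cI|ncI] := pselect (I c); last by apply: aeW => x c' [<-].
    by have := hI c cI; apply: filterS => x /= e c' [<-] _; exact: e.
  by apply: filterS => x e c; apply: (e (pickle c)); exact: pickleK.
apply: filterS => x e Ox; move: (Ox); rewrite {1}(open_bigcup_box oOmega).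
by move=> [c cI bx]; exact: e bx.
Qed.

End du_bois_reymond.

(** * Integrals of partial derivatives *)

Section integral_partial.
Context {R : realType}.

Lemma bounded_support_integrable d (T : measurableType d)
    (mu : {measure set T -> \bar R}) (D : set T) (f : T -> R) (C : R) :
  measurable D -> (mu D < +oo)%E -> measurable_fun setT f ->
  (forall x, `|f x| <= C) -> (forall x, ~ D x -> f x = 0) ->
  mu.-integrable setT (EFin \o f).
Proof.
move=> mD Dfin mf fC f0.
have -> : EFin \o f = (EFin \o f) \_ D.
  apply/funext => x; rewrite restrict_EFin /= /patch.
  by case: ifPn => // /negP xD; rewrite f0// => Dx; apply: xD; exact: mem_set.
rewrite -integrable_mkcond//; apply: measurable_bounded_integrable => //.
  exact: measurable_funTS.
exists C; split; first exact: num_real.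
by move=> y Cy x Dx /=; rewrite (le_trans (fC x))// ltW.
Qed.

Lemma continuous_supp_bounded (T : topologicalType) (K : set T) (f : T -> R) :
  compact K -> continuous f -> (forall x, ~ K x -> f x = 0) ->
  exists C, forall x, `|f x| <= C.
Proof.
move=> cK cf f0.
have : compact (f @` K).
  by apply: continuous_compact => //; exact: continuous_subspaceT.
move=> /compact_bounded [M [_ fM]].
exists (`|M| + 1) => x; have [Kx|nKx] := pselect (K x).
  by apply: (fM (`|M| + 1)); [rewrite (le_lt_trans (ler_norm M))// ltrDl|exists x].
by rewrite f0// normr0 addr_ge0.
Qed.

Lemma continuous_rV (T : topologicalType) n (f : T -> 'rV[R]_n) :
  (forall i, continuous (fun x => f x 0 i)) -> continuous f.
Proof.
move=> cf x; apply/cvg_ballP => e e0.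
have h : \forall y \near x, forall i, `|f x 0 i - f y 0 i| < e.
  apply: filter_forall => i; have := cf i x.
  by move=> /cvgrPdist_lt; exact.
by apply: filterS h => y h; apply/rV_ballP.
Qed.

Lemma rV_cons_continuous_r n (t : R) :
  continuous (fun y : 'rV[R]_n => rV_cons (t, y)).
Proof.
apply: continuous_rV => i; case: (unliftP ord0 i) => [j|] -> y.
  under eq_fun do rewrite mxE liftK /=.
  exact: coord_continuous.
under eq_fun do rewrite mxE unlift_none /=.
exact: cst_continuous.
Qed.

Lemma rV_cons_continuous_l n (y : 'rV[R]_n) :
  continuous (fun t : R => rV_cons (t, y)).
Proof.
apply: continuous_rV => i; case: (unliftP ord0 i) => [j|] -> t.
  under eq_fun do rewrite mxE liftK /=.
  exact: cst_continuous.
under eq_fun do rewrite mxE unlift_none /=.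
exact: cvg_id.
Qed.

Lemma rV_cons_shift0 n (t h : R) (y : 'rV[R]_n) :
  h *: delta_mx 0 ord0 + rV_cons (t, y) = rV_cons (h + t, y).
Proof.
apply/rowP => i; rewrite !mxE eqxx /=; case: unliftP => [j|] -> /=.
  by rewrite mulr0 add0r.
by rewrite mulr1.
Qed.

Lemma rV_cons_shift n (t h : R) (y : 'rV[R]_n) j :
  h *: delta_mx 0 (lift ord0 j) + rV_cons (t, y) =
  rV_cons (t, h *: delta_mx 0 j + y).
Proof.
apply/rowP => i; rewrite !mxE eqxx /=; case: unliftP => [k|] -> /=.
  by rewrite !mxE eqxx /= (inj_eq lift_inj).
by rewrite mulr0 add0r.
Qed.

Definition C1_along n (i : 'I_n) (M : R) (F : 'rV[R]_n -> R) : Prop :=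
  [/\ continuous F, forall x, derivable F x (delta_mx 0 i),
      continuous (partial i F) & forall (x : 'rV[R]_n) j, M < `|x 0 j| -> F x = 0].

Lemma open_coord_gt n (j : 'I_n) (M : R) (x : 'rV[R]_n) :
  M < `|x 0 j| -> nbhs x [set y : 'rV[R]_n | M < `|y 0 j| ].
Proof.
move=> h; have cj : {for x, continuous (fun y : 'rV[R]_n => `|y 0 j|)}.
  apply: continuous_comp; first exact: coord_continuous.
  exact: norm_continuous.
by have := cvgr_gt _ cj; apply.
Qed.

Lemma near0_partial n (i : 'I_n) (F : 'rV[R]_n -> R) (x : 'rV[R]_n) :
  (\forall y \near x, F y = 0) -> partial i F x = 0.
Proof.
move=> F0; rewrite /partial (near_eq_derive (g := cst 0))//.
exact: derive_cst.
Qed.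

Lemma C1_along_partial0 n (i j : 'I_n) M F (x : 'rV[R]_n) : C1_along i M F ->
  M < `|x 0 j| -> partial i F x = 0.
Proof.
move=> [_ _ _ F0] xM; apply: near0_partial.
by apply: filterS (open_coord_gt xM) => y; exact: F0.
Qed.

(** Stated for the composition with a map [phi], because the integral over R^(n+1)
    is taken over a product space, through the map that prepends a coordinate. *)
Lemma C1_along_integrable n d (T : measurableType d)
    (mu : {measure set T -> \bar R}) (phi : T -> 'rV[R]_n) (i : 'I_n) M F :
  measurable_fun setT phi ->
  (forall a b, mu (phi @^-1` box a b) < +oo)%E ->
  C1_along i M F -> mu.-integrable setT (EFin \o (partial i F \o phi)).
Proof.
move=> mphi mufin CF; have [_ _ cdF _] := CF.
pose c : 'rV[R]_n := const_mx (`|M| + 1).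
have supp x : ~ box (- c) c x -> partial i F x = 0.
  move=> /existsNP[j]; rewrite !mxE => /negP; rewrite -ltr_norml -leNgt => h.
  apply: (@C1_along_partial0 _ _ j _ _ _ CF); apply: lt_le_trans h.
  by rewrite (le_lt_trans (ler_norm M))// ltrDl.
have [C hC] : exists C, forall x, `|partial i F x| <= C.
  apply: (@continuous_supp_bounded _ (closed_box (- c) c)) => //.
    exact: compact_closed_box.
  by move=> x nx; apply: supp; apply: contra_not nx; exact: sub_closed_box.
apply: (@bounded_support_integrable _ _ _ (phi @^-1` box (- c) c) _ C) => //.
- by rewrite -[X in measurable X]setTI; apply: mphi => //; exact: measurable_box.
- by apply: measurableT_comp => //; exact: continuous_measurable_rV.
- by move=> x; exact: hC.
- by move=> x; exact: supp.
Qed.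

Lemma integral_derive_line0 (f : R -> R) (M : R) :
  (forall x, derivable f x 1) -> continuous (derive1 f) ->
  (forall x, M < `|x| -> f x = 0) ->
  (\int[lebesgue_measure]_x (derive1 f x)%:E = 0)%E.
Proof.
move=> df cdf f0; pose c : R := `|M| + 1.
have Mc : M < c by rewrite (le_lt_trans (ler_norm M))// ltrDl.
have c0 : 0 < c by rewrite ltr_wpDl.
have cf : continuous f.
  by move=> x; apply: differentiable_continuous; exact/derivable1_diffP.
have -> : (\int[lebesgue_measure]_x (derive1 f x)%:E =
    \int[lebesgue_measure]_(x in `[(- c)%R, c]) (derive1 f x)%:E)%E.
  rewrite [RHS]integral_mkcond; apply: eq_integral => x _.
  rewrite restrict_EFin /= /patch; case: ifPn => // /negP xc; congr EFin.
  have xM : M < `|x|.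
    rewrite (lt_le_trans Mc)// leNgt; apply/negP => h; apply: xc; apply: mem_set.
    by rewrite /= in_itv /= -ler_norml ltW.
  rewrite derive1E (near_eq_derive (g := cst 0)) ?derive_cst//.
  have cn : {for x, continuous (fun y : R => `|y|)} by exact: norm_continuous.
  by have := cvgr_gt _ cn _ xM; move=> /(_ _); apply: filterS => y; exact: f0.
rewrite (@continuous_FTC2 R (derive1 f) f (- c) c).
- by rewrite !f0 ?subee//; rewrite ?normrN (lt_le_trans Mc)// ler_norm.
- lra.
- exact: continuous_subspaceT.
- split; first by move=> x _; exact: df.
    exact: cvg_at_right_filter (cf _).
  exact: cvg_at_left_filter (cf _).
- by move=> x _.
Qed.

(** By Fubini, integrate first along the direction of differentiation: coordinate
    0 is covered by the fundamental theorem of calculus, and the others by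
    induction on the slices. *)
Lemma integral_partial0 n (i : 'I_n) M F : C1_along i M F ->
  (\int[lebesgue_rV n]_x (partial i F x)%:E = 0)%E.
Proof.
elim: n i F => [[]//|n IH] i F CF; have [cF dF cdF F0] := CF.
have iF := @C1_along_integrable _ _ _ (lebesgue_measure \x lebesgue_rV n)%E
  (@rV_cons R n) _ _ _ (@measurable_rV_cons R n)
  (fun a b => lebesgue_rV_box_fin a b) CF.
rewrite [LHS](@integral_pushforward _ _ _ _ _ _ (@measurable_rV_cons R n)
  (lebesgue_measure \x lebesgue_rV n)%E)//; last first.
  apply/measurable_EFinP; exact: continuous_measurable_rV.
rewrite preimage_setT; case: (unliftP ord0 i) CF cF dF cdF F0 iF => [j|] ->.
  move=> CF cF dF cdF F0 iF.
  rewrite -integral12_prod_meas1//= -[RHS](integral0 lebesgue_measure setT).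
  apply: eq_integral => t _.
  pose Ft (y : 'rV[R]_n) := F (rV_cons (t, y)).
  have pE y : partial j Ft y = partial (lift ord0 j) F (rV_cons (t, y)).
    rewrite /partial /derive; set g1 := fun h => h^-1 *: _.
    set g2 := fun h => h^-1 *: _.
    suff -> : g1 = g2 by [].
    by apply/funext => h; rewrite /g1 /g2 /= /shift /= rV_cons_shift.
  have := IH j Ft.
  under eq_integral do rewrite pE.
  apply; split.
  - by move=> y; apply: continuous_comp; [exact: rV_cons_continuous_r|exact: cF].
  - move=> y; rewrite /derivable.
    have -> : (fun h => h^-1 *: ((Ft \o shift y) (h *: delta_mx 0 j) - Ft y)) =
      (fun h => h^-1 *: ((F \o shift (rV_cons (t, y)))
         (h *: delta_mx 0 (lift ord0 j)) - F (rV_cons (t, y)))).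
      by apply/funext => h; rewrite /= /shift /= rV_cons_shift.
    exact: dF.
  - have -> : partial j Ft = partial (lift ord0 j) F \o (fun y => rV_cons (t, y)).
      by apply/funext => y; exact: pE.
    by move=> y; apply: continuous_comp; [exact: rV_cons_continuous_r|exact: cdF].
  - move=> y k yk; apply: (F0 _ (lift ord0 k)).
    by rewrite mxE liftK.
move=> CF cF dF cdF F0 iF.
rewrite -integral21_prod_meas1//= -[RHS](integral0 (lebesgue_rV n) setT).
apply: eq_integral => y _.
pose f (t : R) := F (rV_cons (t, y)).
have qE t : (fun h => h^-1 *: ((f \o shift t) (h *: (1 : R)) - f t)) =
   (fun h => h^-1 *: ((F \o shift (rV_cons (t, y))) (h *: delta_mx 0 ord0) -
      F (rV_cons (t, y)))).
  by apply/funext => h; rewrite /= /shift /= rV_cons_shift0 [h *: 1]mulr1.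
have pE t : derive1 f t = partial ord0 F (rV_cons (t, y)).
  by rewrite derive1E /derive qE.
rewrite /fubini_G; under eq_integral do rewrite /= -pE.
apply: (@integral_derive_line0 _ M).
- by move=> t; rewrite /derivable qE; exact: dF.
- have -> : derive1 f = partial ord0 F \o (fun t => rV_cons (t, y)).
    by apply/funext => t; exact: pE.
  by move=> t; apply: continuous_comp; [exact: rV_cons_continuous_l|exact: cdF].
- move=> t tM; apply: (F0 _ ord0).
  by rewrite mxE unlift_none.
Qed.

End integral_partial.

(** * Weak derivatives and Sobolev spaces *)

Section smooth_closed.
Context {R : realType} {n : nat}.
Implicit Types (v w phi psi : 'rV[R]_n -> R).

Lemma partial_lin i v w (c : R) x :
  derivable v x (delta_mx 0 i) -> derivable w x (delta_mx 0 i) ->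
  partial i (fun y => c * v y + w y) x = c * partial i v x + partial i w x.
Proof.
move=> dv dw; have dcv := derivableZ (k := c) dv.
by have := deriveD dcv dw; rewrite (deriveZ _ dv).
Qed.

Lemma smooth_foldr_lin v w (c : R) (s : seq 'I_n) : smooth v -> smooth w ->
  foldr partial (fun x => c * v x + w x) s =
  (fun x => c * foldr partial v s x + foldr partial w s x).
Proof.
move=> sv sw; elim: s => //= i s ->; apply/funext => x.
by apply: partial_lin; [have [_] := sv s|have [_] := sw s]; apply.
Qed.

Lemma smooth_lin v w (c : R) : smooth v -> smooth w ->
  smooth (fun x => c * v x + w x).
Proof.
move=> sv sw s; rewrite smooth_foldr_lin//.
have [cv dv] := sv s; have [cw dw] := sw s; split.
  move=> x; have hc : {for x, continuous (fun y : 'rV[R]_n => c)}.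
    exact: cst_continuous.
  exact: (continuousD (continuousM hc (cv x)) (cw x)).
move=> i x; apply: (@derivableD _ _ _ (c *: foldr partial v s)) => //.
exact: derivableZ.
Qed.

Lemma test_function_lin (Omega : set 'rV[R]_n) phi psi (c : R) :
  test_function Omega phi -> test_function Omega psi ->
  test_function Omega (fun x => c * phi x + psi x).
Proof.
move=> [s1 [K1 [cK1 K1O phi0]]] [s2 [K2 [cK2 K2O psi0]]].
split; first exact: smooth_lin.
exists (K1 `|` K2); split.
- exact: compactU.
- by move=> x [/K1O|/K2O].
- move=> x /not_orP[h1 h2]; by rewrite phi0// psi0// mulr0 addr0.
Qed.

Lemma test_function0 (Omega : set 'rV[R]_n) : test_function Omega (fun=> 0).
Proof.
split; first by apply: flat_alg_smooth; exact: flat_alg_cst.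
by exists set0; split => //; exact: compact0.
Qed.

End smooth_closed.

Section weak_derivatives.
Context {R : realType} {n : nat}.
Variable Omega : set 'rV[R]_n.
Hypotheses (oO : open Omega) (Ofin : (lebesgue_rV n Omega < +oo)%E).
Local Notation mu := (lebesgue_rV n).
Local Notation L2 := (in_L Omega 2%:E).
Local Notation inner := (inner Omega).
Implicit Types (u v w g h phi psi : 'rV[R]_n -> R) (i : 'I_n).

Let mO : measurable Omega := open_measurable_rV oO.

Lemma partial_supp i phi (K : set 'rV[R]_n) : compact K ->
  (forall x, ~ K x -> phi x = 0) -> forall x, ~ K x -> partial i phi x = 0.
Proof.
move=> cK phi0 x nKx; apply: near0_partial.
have oK : open (~` K).
  by apply: closed_openC; apply: compact_closed => //; exact: norm_hausdorff.
by have := open_nbhs_nbhs (conj oK nKx); apply: filterS => y; exact: phi0.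
Qed.

Lemma continuous_supp_L2 f (K : set 'rV[R]_n) : continuous f -> compact K ->
  (forall x, ~ K x -> f x = 0) -> L2 f.
Proof.
move=> cf cK f0; have [C hC] := continuous_supp_bounded cK cf f0.
apply: (bounded_in_L2 mO (M := C)) => //.
by apply: measurable_funTS; exact: continuous_measurable_rV.
Qed.

Lemma test_L2 phi : test_function Omega phi -> L2 phi.
Proof.
move=> [s [K [cK KO phi0]]]; apply: continuous_supp_L2 cK phi0.
by have [] := s [::].
Qed.

Lemma test_partial_L2 i phi : test_function Omega phi -> L2 (partial i phi).
Proof.
move=> [s [K [cK KO phi0]]]; apply: (continuous_supp_L2 _ cK).
  by have [] := s [:: i].
exact: partial_supp cK phi0.
Qed.

Lemma weak_partial_specE i v g : weak_partial_spec Omega i v g <->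
  L2 g /\ forall phi, test_function Omega phi ->
    inner v (partial i phi) = - inner g phi.
Proof. by []. Qed.

Lemma weak_partial_spec_lin i v w g h (c : R) : L2 v -> L2 w ->
  weak_partial_spec Omega i v g -> weak_partial_spec Omega i w h ->
  weak_partial_spec Omega i (fun x => c * v x + w x) (fun x => c * g x + h x).
Proof.
move=> Lv Lw /weak_partial_specE[Lg vg] /weak_partial_specE[Lh wh].
apply/weak_partial_specE; split; first by apply: in_L2D => //; exact: in_L2Z.
move=> phi tphi; have Lp := test_L2 tphi; have Ldp := test_partial_L2 i tphi.
rewrite !innerDl ?innerZl//; try exact: in_L2Z.
by rewrite vg// wh//; ring.
Qed.

Lemma weak_partial_spec0 i : weak_partial_spec Omega i (fun=> 0) (fun=> 0).
Proof.
apply/weak_partial_specE; split; first exact: in_L20.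
by move=> phi _; rewrite !inner0l// oppr0.
Qed.

(** The weak derivative is selected by a choice operator. This lemma is what makes
    it linear, up to null sets. *)
Lemma weak_partial_spec_uniq i v g h :
  weak_partial_spec Omega i v g -> weak_partial_spec Omega i v h ->
  g = h %[ae mu in Omega].
Proof.
move=> /weak_partial_specE[Lg vg] /weak_partial_specE[Lh vh].
have Lgh := in_L2B Lg Lh.
have L1 : L2 (fun=> 1).
  by apply: (bounded_in_L2 mO (M := 1)) => // x _; rewrite normr1.
have : (fun x => g x - h x) = cst 0 %[ae mu in Omega].
  apply: du_bois_reymond => //.
    have := L2M_integrable mO Lgh L1.
    by under eq_fun do rewrite mulr1.
  move=> phi tphi; have Lp := test_L2 tphi.
  have := innerBl mO Lg Lh Lp; rewrite /inner => ->.
  rewrite -![Rintegral _ _ _]/(inner _ _).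
  by apply/eqP; rewrite subr_eq0 -eqr_opp -vg// -vh.
by apply: filterS => x /= e Ox; apply/eqP; rewrite -subr_eq0 e.
Qed.

Lemma weak_partial_spec_ae i v w g : L2 v -> L2 w -> v = w %[ae mu in Omega] ->
  weak_partial_spec Omega i v g -> weak_partial_spec Omega i w g.
Proof.
move=> Lv Lw vw /weak_partial_specE[Lg vg]; apply/weak_partial_specE.
split=> // phi tphi; rewrite -vg//; apply: inner_ae_l => //.
- exact: test_partial_L2.
- by apply: filterS vw => x /= e Ox; rewrite e.
Qed.

(** Functions that agree almost everywhere have the same weak derivatives, so the
    choice operator selects the same one for both. *)
Lemma weak_partial_ae i v w : L2 v -> L2 w -> v = w %[ae mu in Omega] ->
  weak_partial Omega i v = weak_partial Omega i w.
Proof.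
move=> Lv Lw vw; rewrite /weak_partial; congr xget.
apply/seteqP; split=> g; apply: weak_partial_spec_ae => //.
by apply: filterS vw => x /= e Ox; rewrite e.
Qed.

Lemma weak_partialP i v : in_H1 Omega v ->
  weak_partial_spec Omega i v (weak_partial Omega i v).
Proof.
by move=> [Lv /(_ i)[g vg]]; rewrite /weak_partial; case: xgetP => [h -> //|/(_ g)].
Qed.

Lemma weak_partial_L2 i v : in_H1 Omega v -> L2 (weak_partial Omega i v).
Proof. by move=> /(weak_partialP i)[]. Qed.

Lemma in_H1_lin v w (c : R) : in_H1 Omega v -> in_H1 Omega w ->
  in_H1 Omega (fun x => c * v x + w x).
Proof.
move=> Hv Hw; have [Lv _] := Hv; have [Lw _] := Hw; split.
  by apply: in_L2D => //; exact: in_L2Z.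
move=> i; eexists; apply: weak_partial_spec_lin => //; exact: weak_partialP.
Qed.

Lemma in_H1_0 : in_H1 Omega (fun=> 0).
Proof.
split; first exact: in_L20.
by move=> i; exists (fun=> 0); exact: weak_partial_spec0.
Qed.

Lemma weak_partial_lin i v w (c : R) : in_H1 Omega v -> in_H1 Omega w ->
  weak_partial Omega i (fun x => c * v x + w x) =
  (fun x => c * weak_partial Omega i v x + weak_partial Omega i w x)
  %[ae mu in Omega].
Proof.
move=> Hv Hw; apply: weak_partial_spec_uniq.
  by apply: weak_partialP; exact: in_H1_lin.
have [Lv _] := Hv; have [Lw _] := Hw.
by apply: weak_partial_spec_lin => //; exact: weak_partialP.
Qed.

(** Integration by parts: the integral of a derivative of [phi psi] vanishes. It
    ensures that [v - phi] lies in H^1 for [v] in H^1 and a test function [phi],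
    so that its squared norm is meaningful. *)
Lemma test_weak_partial i phi : test_function Omega phi ->
  weak_partial_spec Omega i phi (partial i phi).
Proof.
move=> tphi; apply/weak_partial_specE; split; first exact: test_partial_L2.
move=> psi tpsi; have Lphi := test_L2 tphi; have Ldphi := test_partial_L2 i tphi.
have Lpsi := test_L2 tpsi; have Ldpsi := test_partial_L2 i tpsi.
have [sphi [K [cK KO phi0]]] := tphi; have [spsi _] := tpsi.
have [cphi dphi] := sphi [::]; have [cpsi dpsi] := spsi [::].
have [cdphi _] := sphi [:: i]; have [cdpsi _] := spsi [:: i].
pose F x := phi x * psi x.
have pF x : partial i F x = phi x * partial i psi x + psi x * partial i phi x.
  exact: deriveM.
have [M hM] : exists M : R, forall (x : 'rV[R]_n) j, M < `|x 0 j| -> F x = 0.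
  have [M [_ KM]] := compact_bounded cK; exists (`|M| + 1) => x j xM.
  rewrite /F phi0 ?mul0r// => Kx; move: xM; rewrite ltNge => /negP; apply.
  apply: le_trans (KM (`|M| + 1) _ x Kx); last first.
    by rewrite (le_lt_trans (ler_norm M))// ltrDl.
  exact: coord_le_norm.
have : C1_along i M F.
  split; last exact: hM.
  - by move=> x; exact: (continuousM (cphi x) (cpsi x)).
  - by move=> x; exact: (derivableM (dphi i x) (dpsi i x)).
  - have -> : partial i F =
        fun x => phi x * partial i psi x + psi x * partial i phi x.
      by apply/funext.
    move=> x; exact: (continuousD (continuousM (cphi x) (cdpsi x))
                                  (continuousM (cpsi x) (cdphi x))).
move=> /integral_partial0 I0.
have : \int[mu]_(x in Omega) partial i F x = 0.
  rewrite Rintegral_mkcond /Rintegral.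
  suff -> : (fun x => ((partial i F \_ Omega) x)%:E) =
      (fun x => (partial i F x)%:E) by rewrite I0.
  apply/funext => x; rewrite /patch; case: ifPn => // /negP nOx; congr EFin.
  have nK : ~ K x by move=> /KO Ox; apply: nOx; exact: mem_set.
  by rewrite pF phi0// (partial_supp i cK phi0)// mulr0 mul0r addr0.
under eq_Rintegral do rewrite pF.
rewrite RintegralD//; try exact: L2M_integrable.
move=> /eqP; rewrite addr_eq0 => /eqP; rewrite /inner => ->.
by congr (- _); apply: eq_Rintegral => x _; rewrite mulrC.
Qed.

Lemma test_H1 phi : test_function Omega phi -> in_H1 Omega phi.
Proof.
move=> tphi; split; first exact: test_L2.
by move=> i; eexists; exact: test_weak_partial tphi.
Qed.

Lemma H1_normsqE v : H1_normsq Omega v =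
  inner v v + \sum_i inner (weak_partial Omega i v) (weak_partial Omega i v).
Proof. by []. Qed.

(** The parallelogram inequality, a substitute for the triangle inequality that
    involves squared norms only. *)
Lemma inner_lin_le u w (c : R) : L2 u -> L2 w ->
  inner (fun x => c * u x + w x) (fun x => c * u x + w x) <=
  2 * c ^+ 2 * inner u u + 2 * inner w w.
Proof.
move=> Lu Lw; have Lcu := in_L2Z c Lu.
have H (e : R) : inner (fun x => c * u x + e * w x) (fun x => c * u x + e * w x) =
    c ^+ 2 * inner u u + 2 * e * c * inner u w + e ^+ 2 * inner w w.
  have Lew := in_L2Z e Lw; have LS := in_L2D Lcu Lew.
  rewrite innerDl// !innerZl// (innerC _ u) (innerC _ w) !innerDl// !innerZl//.
  rewrite (innerC _ w u).
  by ring.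
have := inner_ge0 Omega (fun x => c * u x + -1 * w x); rewrite H.
have -> : (fun x => c * u x + w x) = (fun x => c * u x + 1 * w x).
  by apply/funext => x; rewrite mul1r.
rewrite H; move: (inner u u) (inner u w) (inner w w) => a b d; lra.
Qed.

Lemma H1_normsq_lin u w (c : R) : in_H1 Omega u -> in_H1 Omega w ->
  H1_normsq Omega (fun x => c * u x + w x) <=
  2 * c ^+ 2 * H1_normsq Omega u + 2 * H1_normsq Omega w.
Proof.
move=> Hu Hw; have [Lu _] := Hu; have [Lw _] := Hw; rewrite !H1_normsqE.
rewrite !mulrDr !mulr_sumr addrACA -big_split /= lerD// ?inner_lin_le//.
apply: ler_sum => i _; apply: le_trans (inner_lin_le _ _ _);
  try exact: weak_partial_L2.
have Lh : L2 (fun x => c * weak_partial Omega i u x + weak_partial Omega i w x).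
  by apply: in_L2D => //; [apply: in_L2Z => //|]; exact: weak_partial_L2.
have Lg := weak_partial_L2 i (in_H1_lin c Hu Hw).
have e := weak_partial_lin i c Hu Hw.
by rewrite (inner_ae_l mO Lg Lh Lg e) innerC (inner_ae_l mO Lg Lh Lh e).
Qed.

(** The test functions that approximate [v] and [w] are chosen so close that the
    factors of the parallelogram inequality are absorbed. *)
Lemma in_H10_lin v w (c : R) : in_H10 Omega v -> in_H10 Omega w ->
  in_H10 Omega (fun x => c * v x + w x).
Proof.
move=> [Hv av] [Hw aw]; split; first exact: in_H1_lin.
move=> eps eps0.
have c0 : 0 < 4 * c ^+ 2 + 4 by have := sqr_ge0 c; lra.
have [phi tphi hphi] := av (eps / (4 * c ^+ 2 + 4)) (divr_gt0 eps0 c0).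
have [psi tpsi hpsi] := aw (eps / 4) (divr_gt0 eps0 (ltr0Sn _ _)).
exists (fun x => c * phi x + psi x); first exact: test_function_lin.
have -> : (fun x => c * v x + w x) \- (fun x => c * phi x + psi x) =
    (fun x => c * (v \- phi) x + (w \- psi) x).
  by apply/funext => x /=; ring.
have Hsub u tau : in_H1 Omega u -> test_function Omega tau ->
    in_H1 Omega (u \- tau).
  move=> Hu /test_H1 Ht; have -> : u \- tau = (fun x => -1 * tau x + u x).
    by apply/funext => x /=; ring.
  exact: in_H1_lin.
have le1 := H1_normsq_lin c (Hsub _ _ Hv tphi) (Hsub _ _ Hw tpsi).
apply: (le_lt_trans le1) => {le1}.
have c2 : 0 <= 2 * c ^+ 2 by rewrite mulr_ge0 ?sqr_ge0.
have h1 : 2 * c ^+ 2 * H1_normsq Omega (v \- phi) <= eps / 2.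
  apply: (@le_trans _ _ (2 * c ^+ 2 * (eps / (4 * c ^+ 2 + 4)))).
    exact: (ler_wpM2l c2 (ltW hphi)).
  rewrite mulrA ler_pdivrMr//.
  have -> : eps / 2 * (4 * c ^+ 2 + 4) = 2 * c ^+ 2 * eps + 2 * eps by field.
  by rewrite lerDl mulr_ge0// ltW.
have h2 : 2 * H1_normsq Omega (w \- psi) < eps / 2.
  have -> : eps / 2 = 2 * (eps / 4) by field.
  by rewrite ltr_pM2l.
rewrite [ltRHS]splitr; exact: (ler_ltD h1 h2).
Qed.

End weak_derivatives.

(** * Polynomial functions *)

Section continuous_bigops.
Context {R : realType} {T : topologicalType} {I : Type}.
Implicit Types (r : seq I) (F : I -> T -> R).

Lemma continuous_bigsum r F : (forall i, continuous (F i)) ->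
  continuous (fun x => \sum_(i <- r) F i x).
Proof.
move=> cF x; elim: r => [|i r IH].
  by under eq_fun do rewrite big_nil; exact: cst_continuous.
by under eq_fun do rewrite big_cons; exact: (continuousD (cF i x) IH).
Qed.

Lemma continuous_bigprod r F : (forall i, continuous (F i)) ->
  continuous (fun x => \prod_(i <- r) F i x).
Proof.
move=> cF x; elim: r => [|i r IH].
  by under eq_fun do rewrite big_nil; exact: cst_continuous.
by under eq_fun do rewrite big_cons; exact: (continuousM (cF i x) IH).
Qed.

End continuous_bigops.

Section polynomial_functions.
Context {R : realType} {n : nat}.
Implicit Types (q : mpoly.mpoly n R) (x w : 'rV[R]_n) (a : 'I_n).
Local Notation mev x q := (mpoly.meval (x 0) q).

(** The restriction of [q] to the line [t |-> x + t w], as a polynomial in [t]: it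
    reduces the identity theorem to polynomials in one variable. *)
Definition line_poly x w q : {poly R} :=
  mpoly.mmap (@polyC R) (fun i => (x 0 i)%:P + (w 0 i)%:P * 'X) q.

Lemma line_polyE x w q t : (line_poly x w q).[t] = mev (x + t *: w) q.
Proof.
rewrite mpoly.mevalE /line_poly /mpoly.mmap horner_sum; apply: eq_bigr => m _.
rewrite hornerM hornerC /mpoly.mmap1 horner_prod; congr (_ * _).
by apply: eq_bigr => i _; rewrite horner_exp !hornerE !mxE [w 0 i * t]mulrC.
Qed.

Lemma line_polyM x w q q' :
  line_poly x w (q * q') = line_poly x w q * line_poly x w q'.
Proof. exact: rmorphM. Qed.

Lemma line_polyD x w q q' :
  line_poly x w (q + q') = line_poly x w q + line_poly x w q'.
Proof. exact: raddfD. Qed.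

Lemma line_polyC x w c : line_poly x w (mpoly.mpolyC n c) = c%:P.
Proof. exact: mpoly.mmapC. Qed.

Lemma line_poly_deriv x a q :
  (line_poly x (delta_mx 0 a) q)^`() =
  line_poly x (delta_mx 0 a) (mpoly.mderiv a q).
Proof.
pose P q := (line_poly x (delta_mx 0 a) q)^`() =
  line_poly x (delta_mx 0 a) (mpoly.mderiv a q).
have PC c : P (mpoly.mpolyC n c).
  by rewrite /P line_polyC derivC mpoly.mderivC /line_poly mpoly.mmap0.
have PM q1 q2 : P q1 -> P q2 -> P (q1 * q2).
  rewrite /P => h1 h2.
  by rewrite line_polyM derivM mpoly.mderivM line_polyD !line_polyM h1 h2.
have PX i : P (mpoly.mpolyX R (mpoly.mnm1 i)).
  rewrite /P mpoly.mderivX /line_poly mpoly.mmapZ !mpoly.mmapX mpoly.mmap1U.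
  rewrite derivD derivC add0r derivM derivC mul0r add0r derivX mulr1.
  rewrite !mxE eqxx /= mpoly.mnm1E eq_sym; case: eqP => [<-|_]; last first.
    by rewrite polyC0 !mul0r.
  rewrite (_ : mpoly.mnm_sub _ _ = mpoly.mnm0) ?mpoly.mmap11 ?mulr1//.
  by apply/mpoly.mnmP => j; rewrite mpoly.mnmBE subnn mpoly.mnm0E.
have PXm m : P (mpoly.mpolyX R m).
  rewrite mpoly.mpolyXE_id; apply: (big_ind P).
  - by rewrite -mpoly.mpolyC1; exact: PC.
  - exact: PM.
  - move=> i _; elim: (m i) => [|k IH].
      by rewrite expr0 -mpoly.mpolyC1; exact: PC.
    by rewrite exprS; exact: PM.
elim/mpoly.mpolyind: q => [|c m q _ _ IH].
  by rewrite -(mpoly.mpolyC0 n); exact: PC.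
rewrite -/(P _) in IH *; rewrite -mpoly.mul_mpolyC /P.
rewrite mpoly.mderivD !line_polyD derivD.
by rewrite IH; congr (_ + _); exact: PM.
Qed.

Lemma meval_continuous q : continuous (fun x : 'rV[R]_n => mev x q).
Proof.
under eq_fun do rewrite mpoly.mevalE.
apply: continuous_bigsum => m x.
have hc : {for x, continuous (fun y : 'rV[R]_n => mpoly.mcoeff m q)}.
  exact: cst_continuous.
apply: (continuousM hc); apply: continuous_bigprod => i {hc}{}x.
elim: (m i) => [|k IH].
  by under eq_fun do rewrite expr0; exact: cst_continuous.
under eq_fun do rewrite exprS.
have ci : {for x, continuous (fun y : 'rV[R]_n => y 0 i)}.
  exact: coord_continuous.
exact: (continuousM ci IH).
Qed.

Lemma poly_eq0_near0 (p : {poly R}) (e : R) : 0 < e ->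
  (forall t, `|t| < e -> p.[t] = 0) -> p = 0.
Proof.
move=> e0 p0; pose s := [seq e / k.+2%:R | k <- iota 0 (size p)].
apply: (@roots_geq_poly_eq0 _ p s); last by rewrite size_map size_iota.
- apply/allP => _ /mapP[k _ ->]; apply/eqP/p0.
  rewrite ger0_norm ?divr_ge0 ?(ltW e0)// ltr_pdivrMr// ltr_pMr//.
  by rewrite ltr1n.
- rewrite map_inj_uniq ?iota_uniq// => i j /(mulfI (lt0r_neq0 e0)) /invr_inj.
  by move=> /eqP; rewrite eqr_nat => /eqP [].
Qed.

(** A polynomial in one variable with infinitely many roots is zero; apply this on
    the lines through a point of [U], and then on the lines along the axes. *)
Lemma mpoly_eq0_open q (U : set 'rV[R]_n) : open U -> U !=set0 ->
  (forall x, U x -> mev x q = 0) ->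
  forall x, mev x q = 0 /\ forall a, mev x (mpoly.mderiv a q) = 0.
Proof.
move=> oU [x0 Ux0] q0.
have Q0 (y : 'rV[R]_n) : mev y q = 0.
  have /nbhs_ballP[e /= e0 eU] := open_nbhs_nbhs (conj oU Ux0).
  pose w := y - x0; pose e' := e / (`|w| + 1).
  have w1 : 0 < `|w| + 1 by rewrite ltr_wpDl.
  have L0 : line_poly x0 w q = 0.
    apply: (@poly_eq0_near0 _ e'); first by rewrite divr_gt0.
    move=> t te; rewrite line_polyE; apply/q0/eU.
    rewrite mx_norm_ball /ball_ /= opprD addNKr normrN normrZ.
    apply: (@le_lt_trans _ _ (`|t| * (`|w| + 1))).
      by rewrite ler_wpM2l// lerDl.
    by rewrite -ltr_pdivlMr.
  have := line_polyE x0 w q 1; rewrite L0 horner0 scale1r => ->.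
  by rewrite /w addrC subrK.
move=> x; split=> // a.
have L0 : line_poly x (delta_mx 0 a) q = 0.
  by apply: (@poly_eq0_near0 _ 1) => // t _; rewrite line_polyE.
have := line_polyE x (delta_mx 0 a) (mpoly.mderiv a q) 0.
by rewrite -line_poly_deriv L0 deriv0 horner0 scale0r addr0.
Qed.

(** The points of [U] where [q] does not vanish form an open set, and nonempty open
    sets are not null. *)
Lemma mpoly_ae0_open q (U : set 'rV[R]_n) : open U ->
  {ae lebesgue_rV n, forall x, U x -> mev x q = 0} ->
  forall x, U x -> mev x q = 0.
Proof.
move=> oU q0 x Ux; apply: contrapT => /eqP qx0.
pose V := U `&` [set y : 'rV[R]_n | mev y q != 0].
have oV : open V.
  apply: openI => //; have /continuousP cq := @meval_continuous q.
  by apply: (cq [set z | z != 0]); exact: open_neq.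
have : (lebesgue_rV n).-negligible V.
  apply: negligibleS q0 => y [Uy /eqP qy] /=.
  exact/not_implyP.
move=> /(negligibleP _ (open_measurable_rV oV)) V0.
by have := open_lebesgue_rV_gt0 oV (ex_intro _ x (conj Ux qx0)); rewrite V0 ltxx.
Qed.

End polynomial_functions.

(** * Barycentric coordinates *)

Section barycentric.
Context {R : realType} {d : nat}.
Variable T : 'M[R]_(d.+2, d.+1).
Hypothesis Tnd : Defs.nondegenerate T.
Implicit Types (x w : 'rV[R]_d.+1) (i : 'I_d.+2).

Let G := row_mx T (const_mx 1 : 'cV[R]_d.+2).

(** Nondegeneracy makes the augmented vertex matrix [G] row free and row full, so
    this is the row [l] such that [l *m T = x] and whose entries have sum 1. *)
Definition bary x : 'rV[R]_d.+2 := row_mx x (const_mx 1) *m pinvmx G.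

(** The linear part of the affine map [bary]. *)
Definition bary_dir w : 'rV[R]_d.+2 := row_mx w 0 *m pinvmx G.

Lemma baryK (l : 'rV[R]_d.+2) : \sum_i l 0 i = 1 -> bary (l *m T) = l.
Proof.
move=> l1; rewrite /bary; have -> : row_mx (l *m T) (const_mx 1) = l *m G.
  rewrite mul_mx_row; congr row_mx; apply/rowP => j.
  by rewrite [LHS]mxE [RHS]mxE -[LHS]l1; apply: eq_bigr => i _; rewrite mxE mulr1.
exact: mulmxKp.
Qed.

Lemma mul_bary x : bary x *m T = x /\ \sum_i bary x 0 i = 1.
Proof.
have Gfull : row_full G.
  by rewrite /row_full (eqP Tnd) addn1.
have : bary x *m G = row_mx x (const_mx 1).
  by rewrite /bary mulmxKpV// submx_full.
rewrite mul_mx_row => /eq_row_mx[-> e]; split=> //.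
move/rowP: e => /(_ 0); rewrite !mxE => <-.
by apply: eq_bigr => i _; rewrite [const_mx _ _ _]mxE mulr1.
Qed.

Lemma bary_shift x (t : R) w : bary (x + t *: w) = bary x + t *: bary_dir w.
Proof.
rewrite /bary /bary_dir scalemxAl -mulmxDl scale_row_mx add_row_mx.
by rewrite scaler0 addr0.
Qed.

Lemma bary_shiftE x (t : R) w i :
  bary (x + t *: w) 0 i = bary x 0 i + t * bary_dir w 0 i.
Proof. by rewrite bary_shift [LHS]mxE [X in _ + X]mxE. Qed.

Lemma bary_dir_linE (c : R) w w' i :
  bary_dir (c *: w + w') 0 i = c * bary_dir w 0 i + bary_dir w' 0 i.
Proof.
have -> : bary_dir (c *: w + w') = c *: bary_dir w + bary_dir w'.
  by rewrite /bary_dir scalemxAl -mulmxDl scale_row_mx add_row_mx scaler0 addr0.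
by rewrite [LHS]mxE [X in X + _]mxE.
Qed.

Lemma open_simplexE : open_simplex T = [set x | forall i, 0 < bary x 0 i].
Proof.
apply/seteqP; split=> x /=; first by move=> [l [l0 l1 ->]] i; rewrite baryK.
by move=> x0; have [xT x1] := mul_bary x; exists (bary x).
Qed.

Lemma bary_continuous i : continuous (fun x => bary x 0 i).
Proof.
under eq_fun do rewrite mxE.
apply: continuous_bigsum => j x.
have hj : continuous (fun y : 'rV[R]_d.+1 =>
    (row_mx y (const_mx 1) : 'M[R]_(1, d.+1 + 1)) 0 j).
  case: (splitP j) => j' ej.
    have -> : j = lshift 1 j' by apply/val_inj.
    have -> : (fun y : 'rV[R]_d.+1 => row_mx y (const_mx 1) 0 (lshift 1 j')) =
        (fun y => y 0 j') by apply/funext => y; rewrite row_mxEl.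
    exact: coord_continuous.
  have -> : j = rshift d.+1 j' by apply/val_inj.
  have -> : (fun y : 'rV[R]_d.+1 => row_mx y (const_mx 1) 0 (rshift d.+1 j')) =
      cst 1 by apply/funext => y; rewrite row_mxEr mxE.
  exact: cst_continuous.
have hc (c : R) : {for x, continuous (fun y : 'rV[R]_d.+1 => c)}.
  exact: cst_continuous.
exact: (continuousM (hj x) (hc _)).
Qed.

Lemma open_open_simplex : open (open_simplex T).
Proof.
rewrite open_simplexE openE => x x0; rewrite /interior /=.
have h i : nbhs x [set y | 0 < bary y 0 i].
  by have := cvgr_gt _ (@bary_continuous i x) _ (x0 i); apply.
exact: (filter_forall (nbhs_filter x) h).
Qed.

Lemma open_simplex_nonempty : open_simplex T !=set0.
Proof.
pose l : 'rV[R]_d.+2 := const_mx d.+2%:R^-1.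
exists (l *m T); exists l; split=> //; first by move=> i; rewrite mxE invr_gt0.
under eq_bigr do rewrite mxE.
by rewrite sumr_const card_ord -[LHS]mulr_natr mulVf// pnatr_eq0.
Qed.

(** Facet [i] is the zero set of barycentric coordinate [i], and the others are
    positive in its relative interior. *)
Lemma facet_point_bary i (t : 'rV[R]_d) : ref_simplex t ->
  bary (facet_point (row' i T) t) 0 i = 0 /\
  forall j, 0 < bary (facet_point (row' i T) t) 0 (lift i j).
Proof.
move=> [t0 t1].
pose l : 'rV[R]_d.+2 := \row_k
  if unlift i k is Some j then
    if unlift ord0 j is Some j' then t 0 j' else 1 - \sum_j' t 0 j'
  else 0.
have li : l 0 i = 0 by rewrite mxE unlift_none.
have l0 : l 0 (lift i ord0) = 1 - \sum_j' t 0 j'.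
  by rewrite mxE liftK unlift_none.
have ls j : l 0 (lift i (lift ord0 j)) = t 0 j by rewrite mxE !liftK.
have -> : facet_point (row' i T) t = l *m T.
  apply/rowP => a; rewrite !mxE (bigD1_ord i)//= li mul0r add0r big_ord_recl l0.
  rewrite mulrBl mul1r mulr_suml -addrA; congr (_ + _).
  rewrite addrC -sumrB; apply: eq_bigr => j _; rewrite ls !mxE mulrBr.
  by [].
rewrite baryK; last first.
  rewrite (bigD1_ord i)//= li add0r big_ord_recl l0.
  under [X in _ + X]eq_bigr do rewrite ls.
  by rewrite subrK.
split=> // j; case: (unliftP ord0 j) => [j'|] ->; first by rewrite ls.
by rewrite l0 subr_gt0.
Qed.

End barycentric.

(** * Normals of boundary facets *)

Section dot_product.
Context {R : realType} {n : nat}.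
Implicit Types x y z : 'rV[R]_n.

Lemma dot_linl (c : R) x y z : dot (c *: x + y) z = c * dot x z + dot y z.
Proof.
rewrite /dot mulr_sumr -big_split; apply: eq_bigr => i _ /=.
by rewrite !mxE; ring.
Qed.

Lemma dotC x y : dot x y = dot y x.
Proof. by apply: eq_bigr => i _; rewrite mulrC. Qed.

Lemma dot_ge0 x : 0 <= dot x x.
Proof. by apply: sumr_ge0 => i _; rewrite -expr2 sqr_ge0. Qed.

Lemma dot_eq0 x : dot x x = 0 -> x = 0.
Proof.
move=> /eqP; rewrite psumr_eq0; last by move=> i _; rewrite -expr2 sqr_ge0.
move=> /allP h; apply/rowP => i; rewrite mxE.
by have := h i (mem_index_enum i); rewrite mulf_eq0 orbb => /eqP.
Qed.

End dot_product.

Section facet_normals.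
Context {R : realType} {d : nat}.
Variables (Omega : set 'rV[R]_d.+1) (T : 'M[R]_(d.+2, d.+1)).
Hypotheses (Tnd : Defs.nondegenerate T).
Hypothesis TO : open_simplex T `<=` closure Omega.
Implicit Types (x w nu : 'rV[R]_d.+1) (i : 'I_d.+2).

(** Moving from the facet in a direction that increases coordinate [i] leads into
    the simplex, hence into the closure of [Omega], which the directions of
    positive scalar product with the normal leave at once. *)
Lemma inward_dot_le0 i (t : 'rV[R]_d) nu w :
  ref_simplex t -> is_outward_normal Omega (facet_point (row' i T) t) nu ->
  0 < bary_dir T w 0 i -> dot w nu <= 0.
Proof.
move=> ht [_ _ out] wi; rewrite leNgt; apply/negP => wnu.
have [xi xs] := facet_point_bary Tnd i ht; set x := facet_point _ _ in out xi xs.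
have near_in : \forall s \near (0 : R)^'+, closure Omega (x + s *: w).
  have near_pos : forall j, \forall s \near (0 : R)^'+, 0 < bary T (x + s *: w) 0 j.
    move=> j.
    have cj : bary T x 0 j + s * bary_dir T w 0 j @[s --> 0^'+] --> bary T x 0 j.
      suff : bary T x 0 j + s * bary_dir T w 0 j @[s --> 0^'+] -->
          bary T x 0 j + 0 * bary_dir T w 0 j.
        by rewrite mul0r addr0.
      apply: cvgD; first exact: cvg_cst.
      apply: cvgM; last exact: cvg_cst.
      exact/cvg_at_right_filter/cvg_id.
    case: (unliftP i j) => [k|] ej.
      have := cvgr_gt _ cj _; rewrite ej => /(_ _ _ (xs k)).
      by apply: filterS => s; rewrite bary_shiftE.
    by near=> s; rewrite ej bary_shiftE xi add0r mulr_gt0.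
  have : \forall s \near (0 : R)^'+, forall j, 0 < bary T (x + s *: w) 0 j.
    exact: filter_forall.
  by apply: filterS => s h; apply: TO; rewrite open_simplexE.
have near_out := out w wnu.
have [s [s1 s2]] : exists s : R,
    closure Omega (x + s *: w) /\ ~ closure Omega (x + s *: w).
  by apply: (@filter_ex _ (0 : R)^'+); apply: filterI.
exact: s2 s1.
Unshelve. all: by end_near. Qed.

(** If the normals [nu] and [nu'] differed, then [w = nu' - nu] would leave [Omega]
    at the second point and [- w] at the first, so that [w] would be parallel to
    the facet. Tilting [w] slightly into the simplex gives a direction that both
    enters and leaves the closure of [Omega]. *)
Lemma normal_facet_cst i (t t' : 'rV[R]_d) nu nu' :
  ref_simplex t -> ref_simplex t' ->
  is_outward_normal Omega (facet_point (row' i T) t) nu ->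
  is_outward_normal Omega (facet_point (row' i T) t') nu' -> nu = nu'.
Proof.
move=> ht ht' hn hn'; have [nu1 _ _] := hn; have [nu1' _ _] := hn'.
apply: contrapT => /eqP nn'.
pose w := nu' - nu; pose c := dot nu nu'.
have wE : w = -1 *: nu + nu' by rewrite scaleN1r addrC.
have wnu : dot w nu = c - 1 by rewrite wE dot_linl nu1 (dotC nu'); rewrite /c; ring.
have wnu' : dot w nu' = 1 - c by rewrite wE dot_linl nu1' /c; ring.
have c1 : 0 < 1 - c.
  have : 0 < dot w w.
    rewrite lt_neqAle dot_ge0 andbT eq_sym; apply/eqP => /dot_eq0 /eqP.
    by rewrite subr_eq0 eq_sym (negbTE nn').
  have -> : dot w w = 2 * (1 - c).
    by rewrite {1}wE dot_linl dotC wnu dotC wnu'; ring.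
  by rewrite pmulr_rgt0.
have [xi xs] := facet_point_bary Tnd i ht; set x := facet_point _ _ in hn xi xs.
have [v vi] : exists v, bary_dir T v 0 i = 1.
  exists (row i T - x).
  have := bary_shiftE T x 1 (row i T - x) i; rewrite scale1r addrC subrK mul1r.
  rewrite rowE baryK//; last first.
    rewrite (bigD1 i)//= big1 ?addr0; first by rewrite mxE !eqxx.
    by move=> j ji; rewrite mxE (negbTE ji) andbF.
  by rewrite mxE !eqxx xi add0r => <-.
have Li0 : bary_dir T w 0 i <= 0.
  rewrite leNgt; apply/negP => /(inward_dot_le0 ht' hn').
  by rewrite wnu' leNgt c1.
have Li0' : 0 <= bary_dir T w 0 i.
  rewrite leNgt; apply/negP => h.
  have : 0 < bary_dir T (-2 *: w + w) 0 i by rewrite bary_dir_linE; lra.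
  by move=> /(inward_dot_le0 ht hn); rewrite dot_linl wnu; lra.
have wi : bary_dir T w 0 i = 0 by apply/eqP; rewrite eq_le Li0.
(* The tilt is so small that [e *: v + w] still leaves [Omega]. *)
pose e := (1 - c) / (2 * (`|dot v nu'| + 1)).
have dv : 0 < `|dot v nu'| + 1 by rewrite ltr_wpDl.
have e0 : 0 < e by rewrite divr_gt0// mulr_gt0.
have : 0 < bary_dir T (e *: v + w) 0 i by rewrite bary_dir_linE vi wi mulr1 addr0.
move=> /(inward_dot_le0 ht' hn'); rewrite dot_linl wnu'.
have : `|e * dot v nu'| <= (1 - c) / 2.
  rewrite normrM gtr0_norm//.
  have -> : e * `|dot v nu'| = (1 - c) / 2 * (`|dot v nu'| / (`|dot v nu'| + 1)).
    by rewrite /e; field; rewrite gt_eqF.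
  apply: ler_piMr; first by rewrite divr_ge0// ltW.
  by rewrite ler_pdivrMr// mul1r lerDl.
rewrite ler_norml => /andP[h _]; move: c1 h; move: (e * _) => z; lra.
Qed.

End facet_normals.

(** * Traces and boundary integrals *)

Section facet_integrals.
Context {R : realType} {d n : nat}.
Local Notation ref := (@ref_simplex R d).
Local Notation mu := (lebesgue_rV d).

Lemma ref_simplex_box : ref `<=` box (const_mx 0) (const_mx 2).
Proof.
move=> t [t0 t1] j; rewrite !mxE t0 /=.
apply: (@lt_trans _ _ 1); last by rewrite ltr1n.
apply: le_lt_trans t1; rewrite (bigD1 j)//= lerDl.
by apply: sumr_ge0 => i _; exact: ltW.
Qed.

Lemma open_ref_simplex : open ref.
Proof.
rewrite openE => t [t0 t1]; rewrite /interior /=.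
apply: filterI.
  have h j : nbhs t [set y : 'rV[R]_d | 0 < y 0 j].
    have cj : {for t, continuous (fun y : 'rV[R]_d => y 0 j)}.
      exact: coord_continuous.
    by have := cvgr_gt _ cj _ (t0 j); apply.
  exact: (filter_forall (nbhs_filter t) h).
have cs : continuous (fun y : 'rV[R]_d => \sum_j y 0 j).
  by apply: continuous_bigsum => j; exact: coord_continuous.
by have := cvgr_lt _ (cs t) _ t1; apply.
Qed.

Lemma continuous_ref_integrable (g : 'rV[R]_d -> R) : continuous g ->
  mu.-integrable ref (EFin \o g).
Proof.
move=> cg; apply: measurable_bounded_integrable.
- by apply: open_measurable_rV; exact: open_ref_simplex.
- apply: le_lt_trans (lebesgue_rV_box_fin (const_mx 0) (const_mx 2)).
  apply: le_measure; rewrite ?inE; last exact: ref_simplex_box.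
    by apply: open_measurable_rV; exact: open_ref_simplex.
  exact: measurable_box.
- by apply: measurable_funTS; exact: continuous_measurable_rV.
have : compact (g @` closed_box (const_mx 0) (const_mx 2)).
  apply: continuous_compact; first exact: continuous_subspaceT.
  exact: compact_closed_box.
move=> /compact_bounded [M [Mr gM]]; exists M; split=> // y My t tr.
apply: (gM y My); exists t => //.
by apply: sub_closed_box; exact: ref_simplex_box.
Qed.

Lemma facet_point_continuous (F : 'M[R]_(d.+1, n)) : continuous (facet_point F).
Proof.
apply: continuous_rV => a.
have -> : (fun t => facet_point F t 0 a) = (fun t =>
    F ord0 a + \sum_j t 0 j * facet_edges F j a).
  by apply/funext => t; rewrite /facet_point !mxE.
have hc (c : R) : continuous (fun y : 'rV[R]_d => c) by exact: cst_continuous.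
move=> t; apply: (continuousD (hc _ t)).
apply: (continuous_bigsum
  (F := fun j (y : 'rV[R]_d) => y 0 j * facet_edges F j a)) => j y.
have cj : {for y, continuous (fun y : 'rV[R]_d => y 0 j)}.
  exact: coord_continuous.
exact: (continuousM cj (hc _ y)).
Qed.

(** The normal field is only specified in the relative interior of the facets, so
    continuity is required of a function that agrees with [g] there. *)
Definition facet_continuous (F : 'M[R]_(d.+1, n)) (g : 'rV[R]_n -> R) : Prop :=
  exists2 g0, continuous g0 &
    forall t, ref t -> g (facet_point F t) = g0 (facet_point F t).

Lemma facet_integrable F g : facet_continuous F g ->
  mu.-integrable ref (EFin \o (fun t => g (facet_point F t))).
Proof.
move=> [g0 cg0 gE].
have mref : measurable ref by apply: open_measurable_rV; exact: open_ref_simplex.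
apply: (@eq_integrable _ _ _ mu ref mref (EFin \o (g0 \o facet_point F))).
  by move=> t /set_mem tr; rewrite /= gE.
apply: continuous_ref_integrable => t.
by apply: continuous_comp; [exact: facet_point_continuous|exact: cg0].
Qed.

Lemma facet_integral_lin F g h (c : R) :
  facet_continuous F g -> facet_continuous F h ->
  facet_integral F (fun x => c * g x + h x) =
  c * facet_integral F g + facet_integral F h.
Proof.
move=> /facet_integrable ig /facet_integrable ih.
have mref : measurable ref by apply: open_measurable_rV; exact: open_ref_simplex.
rewrite /facet_integral RintegralD//.
  by rewrite RintegralZl//; ring.
by apply: (eq_integrable mref _ _ _ (integrableZl mref c ig)) .
Qed.

End facet_integrals.

Section boundary.
Context {R : realType} {d nT : nat}.
Variables (Omega : set 'rV[R]_d.+1) (T : 'I_nT -> 'M[R]_(d.+2, d.+1)).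
Variables (n : 'rV[R]_d.+1 -> 'rV[R]_d.+1) (p : nat).
Hypotheses (oO : open Omega).
Hypotheses (Tconf : conforming_triangulation Omega T).
Hypothesis nP : outward_normal_field Omega T n.
Local Notation mu := (lebesgue_rV d.+1).
Local Notation mev x q := (mpoly.meval (x 0) q).
Implicit Types (V W Phi Psi : 'rV[R]_d.+1 -> R).

Let Tnd k : Defs.nondegenerate (T k).
Proof. by case: Tconf. Qed.

Lemma open_simplex_closure k : open_simplex (T k) `<=` closure Omega.
Proof.
case: Tconf => _ _ _ <- x xk; exists k => //; exact: subset_closure.
Qed.

Lemma boundary_integral_lin (g h : 'I_nT -> 'rV[R]_d.+1 -> R) (c : R) :
  (forall k i, boundary_facet Omega T k i ->
    facet_continuous (row' i (T k)) (g k)) ->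
  (forall k i, boundary_facet Omega T k i ->
    facet_continuous (row' i (T k)) (h k)) ->
  boundary_integral Omega T (fun k x => c * g k x + h k x) =
  c * boundary_integral Omega T g + boundary_integral Omega T h.
Proof.
move=> cg ch; rewrite /boundary_integral mulr_sumr -big_split.
apply: eq_bigr => k _ /=; rewrite mulr_sumr -big_split.
apply: eq_bigr => i ki /=; apply: facet_integral_lin; [exact: cg|exact: ch].
Qed.

Lemma normal_facet_continuous k i (b : 'I_d.+1) (P Q : mpoly.mpoly d.+1 R) :
  boundary_facet Omega T k i ->
  facet_continuous (row' i (T k)) (fun x => mev x P * n x 0 b * mev x Q).
Proof.
move=> ki.
have [[t0 ht0]|no] := pselect (exists t0 : 'rV[R]_d, ref_simplex t0); last first.
  exists (fun=> 0); first by move=> x; exact: cst_continuous.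
  by move=> t tr; case: no; exists t.
pose nu := n (facet_point (row' i (T k)) t0).
exists (fun x : 'rV[R]_d.+1 => mev x P * nu 0 b * mev x Q).
  move=> x; have hc : {for x, continuous (fun y : 'rV[R]_d.+1 => nu 0 b)}.
    exact: cst_continuous.
  exact: (continuousM (continuousM (@meval_continuous _ _ P x) hc)
                      (@meval_continuous _ _ Q x)).
move=> t tr; congr (_ * _ * _).
by rewrite (normal_facet_cst (Tnd k) (@open_simplex_closure k) tr ht0
  (nP ki tr) (nP ki ht0)).
Qed.

Lemma element_polyP V k : in_FE Omega T p V ->
  forall x, open_simplex (T k) x -> V x = mev x (element_poly T V k).
Proof.
move=> [_ /(_ k)[q _ hq]]; rewrite /element_poly.
by case: xgetP => [r -> //|/(_ q)].
Qed.

(** The open element lies in the closure of [Omega], hence meets [Omega] in a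
    nonempty open set, which is enough to identify polynomials. *)
Lemma element_poly_ae V k (q : mpoly.mpoly d.+1 R) : in_FE Omega T p V ->
  {ae mu, forall x, Omega x -> open_simplex (T k) x -> V x = mev x q} ->
  forall x, trace T V k x = mev x q /\
    forall a, trace_partial T a V k x = mev x (mpoly.mderiv a q).
Proof.
move=> HV ae.
pose U := open_simplex (T k) `&` Omega.
have oU : open U by apply: openI => //; apply: open_open_simplex; exact: Tnd.
have Une : U !=set0.
  have [x xk] := open_simplex_nonempty (T k).
  have := open_simplex_closure xk => /(_ (open_simplex (T k))) h.
  have [|y [Oy yk]] := h; last by exists y.
  by apply: open_nbhs_nbhs; split=> //; apply: open_open_simplex; exact: Tnd.
have U0 x : U x -> mev x (element_poly T V k - q) = 0.
  move: x; apply: mpoly_ae0_open => //.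
  apply: filterS ae => x h [xk Ox].
  by rewrite mpoly.mevalB -(element_polyP HV)// h// subrr.
move=> x; have [h0 h1] := mpoly_eq0_open oU Une U0 x; split.
  by apply/eqP; rewrite -subr_eq0 -mpoly.mevalB h0.
by move=> a; apply/eqP; rewrite -subr_eq0 -mpoly.mevalB -mpoly.mderivB h1.
Qed.

Lemma in_FE_lin V W (c : R) : (mu Omega < +oo)%E ->
  in_FE Omega T p V -> in_FE Omega T p W ->
  in_FE Omega T p (fun x => c * V x + W x).
Proof.
move=> Ofin [HV pV] [HW pW]; split; first exact: in_H1_lin.
move=> k; have [q1 s1 e1] := pV k; have [q2 s2 e2] := pW k.
exists (c *: q1 + q2); last first.
  by move=> x xk; rewrite mpoly.mevalD mpoly.mevalZ e1// e2.
apply: leq_trans (mpoly.msizeD_le _ _) _.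
rewrite geq_max s2 andbT; apply: leq_trans s1; exact: mpoly.msizeZ_le.
Qed.

End boundary.

(** * The finite element Hessian and the linear system *)

Section lincomb_functional.
Context {R : realType} {n N : nat}.
Variable S : set ('rV[R]_n -> R).
Hypothesis S0 : S (fun=> 0).
Hypothesis S_lin : forall (c : R) v w, S v -> S w -> S (fun x => c * v x + w x).
Lemma lincomb_closed (Phi : 'I_N -> 'rV[R]_n -> R) (u : 'cV[R]_N) :
  (forall j, S (Phi j)) -> S (lincomb Phi u).
Proof.
move=> SPhi; rewrite /lincomb; elim: (index_enum _) => [|j r IHS].
  by under eq_fun do rewrite big_nil; exact: S0.
by under eq_fun do rewrite big_cons; exact: S_lin.
Qed.

Lemma lincomb_functional (L : ('rV[R]_n -> R) -> R)
    (Phi : 'I_N -> 'rV[R]_n -> R) (u : 'cV[R]_N) :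
  (forall (c : R) v w, S v -> S w ->
    L (fun x => c * v x + w x) = c * L v + L w) ->
  (forall j, S (Phi j)) -> L (lincomb Phi u) = \sum_j u j 0 * L (Phi j).
Proof.
move=> L_lin SPhi; have L0 : L (fun=> 0) = 0.
  have := L_lin 1 _ _ S0 S0.
  have -> : (fun x : 'rV[R]_n => 1 * 0 + 0 : R) = fun=> 0.
    by apply/funext => x; rewrite mul1r addr0.
  by rewrite mul1r => /eqP; rewrite -subr_eq0 opprD addNKr oppr_eq0 => /eqP.
suff [] : S (fun x => \sum_j u j 0 * Phi j x) /\
    L (fun x => \sum_j u j 0 * Phi j x) = \sum_j u j 0 * L (Phi j) by [].
elim: (index_enum _) => [|j r [IHS IHL]].
  by under eq_fun do rewrite big_nil; rewrite big_nil.
under eq_fun do rewrite big_cons.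
by rewrite big_cons L_lin// IHL; split=> //; exact: S_lin.
Qed.

End lincomb_functional.

Section discrete_hessian.
Context {R : realType} {d nT : nat}.
Variables (Omega : set 'rV[R]_d.+1) (T : 'I_nT -> 'M[R]_(d.+2, d.+1)).
Variables (n : 'rV[R]_d.+1 -> 'rV[R]_d.+1) (p : nat).
Hypotheses (oO : open Omega) (bO : bounded_set Omega).
Hypotheses (Tconf : conforming_triangulation Omega T).
Hypothesis nP : outward_normal_field Omega T n.
Local Notation mu := (lebesgue_rV d.+1).
Local Notation inner := (inner Omega).
Local Notation L2 := (in_L Omega 2%:E).
Local Notation FE := (in_FE Omega T p).
Local Notation FE0 := (in_FE0 Omega T p).
Implicit Types (V W Phi Psi : 'rV[R]_d.+1 -> R) (a b : 'I_d.+1).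

Let mO : measurable Omega := open_measurable_rV oO.
Let Ofin : (mu Omega < +oo)%E := bounded_lebesgue_rV_fin mO bO.

Lemma FE_L2 V : FE V -> L2 V. Proof. by move=> [[]]. Qed.

Lemma FE_linear (c : R) V W : FE V -> FE W -> FE (fun x => c * V x + W x).
Proof. exact: in_FE_lin. Qed.

Lemma in_FE_0 : FE (fun=> 0).
Proof.
split; first exact: in_H1_0.
by move=> k; exists 0 => [|x _]; rewrite ?mpoly.mmeasure0 ?mpoly.meval0.
Qed.

Lemma in_FE0_0 : FE0 (fun=> 0).
Proof.
split; first exact: in_FE_0.
split; first exact: in_H1_0.
move=> eps eps0; exists (fun=> 0); first exact: test_function0.
have -> : (fun=> 0) \- (fun=> 0) = (fun=> 0) :> ('rV[R]_d.+1 -> R).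
  by apply/funext => x /=; rewrite subr0.
rewrite H1_normsqE inner0l// big1 ?addr0// => i _.
have w0 : weak_partial Omega i (fun=> 0) = (fun=> 0) %[ae mu in Omega].
  apply: (weak_partial_spec_uniq oO Ofin (v := fun=> 0)).
    by apply: weak_partialP; exact: in_H1_0.
  exact: weak_partial_spec0.
have Lw := weak_partial_L2 i (in_H1_0 oO).
by rewrite (inner_ae_l mO Lw (in_L20 Omega) Lw w0) inner0l.
Qed.

Lemma in_FE0_lin (c : R) V W : FE0 V -> FE0 W -> FE0 (fun x => c * V x + W x).
Proof.
move=> [FV HV] [FW HW]; split; first exact: in_FE_lin.
exact: in_H10_lin.
Qed.

Lemma trace_lin (c : R) V W k x : FE V -> FE W ->
  trace T (fun x => c * V x + W x) k x = c * trace T V k x + trace T W k x /\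
  forall a, trace_partial T a (fun x => c * V x + W x) k x =
    c * trace_partial T a V k x + trace_partial T a W k x.
Proof.
move=> FV FW; have FVW := FE_linear c FV FW.
have [|h0 h1] := @element_poly_ae _ _ _ _ _ _ oO Tconf _ k
    (c *: element_poly T V k + element_poly T W k) FVW _ x.
  apply: aeW => y _ yk.
  by rewrite mpoly.mevalD mpoly.mevalZ -(element_polyP FV)// -(element_polyP FW).
rewrite h0 mpoly.mevalD mpoly.mevalZ; split=> // a.
by rewrite h1 mpoly.mderivD mpoly.mderivZ mpoly.mevalD mpoly.mevalZ.
Qed.

Lemma trace_ae V W k x : FE V -> FE W -> V = W %[ae mu in Omega] ->
  trace T V k x = trace T W k x /\
  forall a, trace_partial T a V k x = trace_partial T a W k x.
Proof.
move=> FV FW VW.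
apply: (@element_poly_ae _ _ _ _ _ _ oO Tconf V k (element_poly T W k) FV).
by apply: filterS VW => y /= e Oy yk; rewrite e// -(element_polyP FW).
Qed.

Lemma inner_weak_partial_lin a (c : R) V W g : in_H1 Omega V -> in_H1 Omega W ->
  L2 g -> inner (weak_partial Omega a (fun x => c * V x + W x)) g =
  c * inner (weak_partial Omega a V) g + inner (weak_partial Omega a W) g.
Proof.
move=> HV HW Lg; have HVW := in_H1_lin oO Ofin c HV HW.
have LV := weak_partial_L2 a HV; have LW := weak_partial_L2 a HW.
have LcV := in_L2Z c LV.
rewrite (inner_ae_l mO (weak_partial_L2 a HVW) (in_L2D LcV LW) Lg
  (weak_partial_lin oO Ofin a c HV HW)).
by rewrite (innerDl mO LcV LW Lg) (innerZl mO c LV Lg).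
Qed.

Lemma inner_weak_partial_linr a (c : R) V W g : in_H1 Omega V -> in_H1 Omega W ->
  L2 g -> inner g (weak_partial Omega a (fun x => c * V x + W x)) =
  c * inner g (weak_partial Omega a V) + inner g (weak_partial Omega a W).
Proof.
move=> HV HW Lg; apply: etrans (innerC _ _ _) _.
apply: etrans (inner_weak_partial_lin a c HV HW Lg) _.
by congr (_ * _ + _); exact: innerC.
Qed.

(** The right-hand side of the weak form that defines the finite element Hessian
    of [V], tested with [Phi]. *)
Definition hess_form a b V Phi : R :=
  - inner (weak_partial Omega a V) (weak_partial Omega b Phi)
  + boundary_integral Omega T
      (fun k x => trace_partial T a V k x * n x 0 b * trace T Phi k x).

Lemma integrand_continuous a b V Phi k i : boundary_facet Omega T k i ->
  facet_continuous (row' i (T k))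
    (fun x => trace_partial T a V k x * n x 0 b * trace T Phi k x).
Proof.
exact: (normal_facet_continuous Tconf nP b
  (mpoly.mderiv a (element_poly T V k)) (element_poly T Phi k)).
Qed.

Lemma hess_form_linl a b Phi (c : R) V W : FE Phi -> FE V -> FE W ->
  hess_form a b (fun x => c * V x + W x) Phi =
  c * hess_form a b V Phi + hess_form a b W Phi.
Proof.
move=> FP FV FW; have [HP _] := FP; have [HV _] := FV; have [HW _] := FW.
rewrite /hess_form (inner_weak_partial_lin a c HV HW (weak_partial_L2 b HP)).
have -> : (fun k x => trace_partial T a (fun x0 => c * V x0 + W x0) k x *
     n x 0 b * trace T Phi k x) =
   (fun k x => c * (trace_partial T a V k x * n x 0 b * trace T Phi k x) +
     trace_partial T a W k x * n x 0 b * trace T Phi k x).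
  apply/funext => k; apply/funext => x.
  by have [_ ->] := trace_lin c k x FV FW; ring.
rewrite boundary_integral_lin; first by rewrite opprD mulrDr mulrN addrACA.
  by move=> k i ki; exact: integrand_continuous.
by move=> k i ki; exact: integrand_continuous.
Qed.

Lemma hess_form_linr a b V (c : R) Phi Psi : FE V -> FE Phi -> FE Psi ->
  hess_form a b V (fun x => c * Phi x + Psi x) =
  c * hess_form a b V Phi + hess_form a b V Psi.
Proof.
move=> FV FP FQ; have [HV _] := FV; have [HP _] := FP; have [HQ _] := FQ.
transitivity (- (c * inner (weak_partial Omega a V) (weak_partial Omega b Phi) +
    inner (weak_partial Omega a V) (weak_partial Omega b Psi)) +
  (c * boundary_integral Omega T
      (fun k x => trace_partial T a V k x * n x 0 b * trace T Phi k x) +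
   boundary_integral Omega T
      (fun k x => trace_partial T a V k x * n x 0 b * trace T Psi k x)));
  last by rewrite opprD mulrDr mulrN addrACA.
congr (- _ + _).
  exact: (inner_weak_partial_linr b c HP HQ (weak_partial_L2 a HV)).
have -> : (fun k x => trace_partial T a V k x * n x 0 b *
     trace T (fun x0 => c * Phi x0 + Psi x0) k x) =
   (fun k x => c * (trace_partial T a V k x * n x 0 b * trace T Phi k x) +
     trace_partial T a V k x * n x 0 b * trace T Psi k x).
  apply/funext => k; apply/funext => x.
  by have [-> _] := trace_lin c k x FP FQ; ring.
rewrite boundary_integral_lin//.
  by move=> k i ki; exact: integrand_continuous.
by move=> k i ki; exact: integrand_continuous.
Qed.

Lemma hess_form_ael a b V W Phi : FE V -> FE W -> V = W %[ae mu in Omega] ->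
  hess_form a b V Phi = hess_form a b W Phi.
Proof.
move=> FV FW VW; rewrite /hess_form.
rewrite (weak_partial_ae oO Ofin a (FE_L2 FV) (FE_L2 FW) VW).
congr (_ + boundary_integral _ _ _); apply/funext => k; apply/funext => x.
by have [_ ->] := trace_ae k x FV FW VW.
Qed.

Lemma hess_form_aer a b V Phi Psi : FE Phi -> FE Psi ->
  Phi = Psi %[ae mu in Omega] -> hess_form a b V Phi = hess_form a b V Psi.
Proof.
move=> FV FW VW; rewrite /hess_form.
rewrite (weak_partial_ae oO Ofin b (FE_L2 FV) (FE_L2 FW) VW).
congr (_ + boundary_integral _ _ _); apply/funext => k; apply/funext => x.
by have [-> _] := trace_ae k x FV FW VW.
Qed.

Lemma is_FE_hessianE V H : is_FE_hessian Omega T p n V H <->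
  (forall a b, FE (fun x => H x a b)) /\
  forall Phi, FE Phi -> forall a b,
    inner (fun x => H x a b) Phi = hess_form a b V Phi.
Proof. by []. Qed.

Section basis.
Context {N0 Nb : nat}.
Variables (Phi0 : 'I_N0 -> 'rV[R]_d.+1 -> R) (Phib : 'I_Nb -> 'rV[R]_d.+1 -> R).
Hypothesis Phi0_basis : is_basis Omega FE0 Phi0.
Local Notation Phi := (full_basis Phi0 Phib).
Hypothesis Phi_basis : is_basis Omega FE Phi.
Local Notation M := (matM Omega Phi0 Phib).
Local Notation C := (matC Omega T n Phi0 Phib).

Let Phi_FE j : FE (Phi j). Proof. by case: Phi_basis. Qed.
Let Phi0_FE0 j : FE0 (Phi0 j). Proof. by case: Phi0_basis. Qed.
Let Phi0_FE j : FE (Phi0 j). Proof. by have [] := Phi0_FE0 j. Qed.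

Lemma lincomb_FE c : FE (lincomb Phi c).
Proof. exact: (lincomb_closed in_FE_0 FE_linear _ Phi_FE). Qed.

Lemma lincomb_FE0 u : FE0 (lincomb Phi0 u).
Proof. exact: (lincomb_closed in_FE0_0 in_FE0_lin _ Phi0_FE0). Qed.

Lemma inner_lincomb N (F : 'I_N -> 'rV[R]_d.+1 -> R) (c : 'cV[R]_N) g :
  (forall j, L2 (F j)) -> L2 g ->
  inner (lincomb F c) g = \sum_j c j 0 * inner (F j) g.
Proof.
move=> LF Lg.
have h (e : R) v w : L2 v -> L2 w -> L2 (fun x => e * v x + w x).
  by move=> Lv Lw; apply: in_L2D => //; exact: in_L2Z.
apply: (lincomb_functional (L := inner^~ g) (in_L20 Omega) h) LF.
move=> e v w Lv Lw.
by rewrite (innerDl mO (in_L2Z e Lv) Lw Lg) (innerZl mO e Lv Lg).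
Qed.

Lemma matM_lincomb c i : (M *m c) i 0 = inner (lincomb Phi c) (Phi i).
Proof.
rewrite mxE inner_lincomb//; try by move=> *; exact: FE_L2.
  apply: eq_bigr => j _; rewrite mxE mulrC; congr (_ * _).
  by rewrite -/(inner _ _) innerC.
Qed.

(** A vector [v] in the kernel of the mass matrix is the coefficient vector of a
    function of zero norm. *)
Lemma matM_unit : M \in unitmx.
Proof.
rewrite unitmxE unitfE; apply/det0P => -[v v0 vM].
have MT : M^T = M by apply/matrixP => i j; rewrite !mxE; exact: innerC.
have Mv : M *m v^T = 0 by rewrite -MT -trmx_mul vM trmx0.
have L : L2 (lincomb Phi v^T) by apply: FE_L2; exact: lincomb_FE.
have : inner (lincomb Phi v^T) (lincomb Phi v^T) = 0.
  rewrite inner_lincomb//; last by move=> j; exact: FE_L2.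
  by rewrite big1// => j _; rewrite innerC -matM_lincomb Mv [X in _ * X]mxE mulr0.
move=> /(inner_eq0 mO L); case: Phi_basis => _ inj _ /inj /(congr1 trmx).
by rewrite trmxK trmx0 => v00; rewrite v00 eqxx in v0.
Qed.

Lemma matCE a b i j : C a b i j = hess_form a b (Phi0 j) (Phi i).
Proof.
rewrite mxE.
have e2 : (fun k x =>
      trace T (Phi i) k x * n x 0 b * trace_partial T a (Phi0 j) k x) =
    (fun k x => trace_partial T a (Phi0 j) k x * n x 0 b * trace T (Phi i) k x).
  by apply/funext => k; apply/funext => x; rewrite mulrC mulrA mulrAC.
exact: (f_equal2 (fun y g => - y + boundary_integral Omega T g)
  (innerC Omega (weak_partial Omega b (Phi i)) (weak_partial Omega a (Phi0 j))) e2).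
Qed.

Lemma matC_lincomb a b u i :
  (C a b *m u) i 0 = hess_form a b (lincomb Phi0 u) (Phi i).
Proof.
rewrite (lincomb_functional (L := fun V => hess_form a b V (Phi i))
  in_FE_0 FE_linear _ _ Phi0_FE); last first.
  by move=> c V W FV FW; exact: hess_form_linl.
by rewrite mxE; apply: eq_bigr => j _; rewrite matCE mulrC.
Qed.

(** Testing the weak form with the basis functions gives the linear system
    [M c = C u] for the coefficients [c] of an entry of the Hessian of
    [lincomb Phi0 u]. The solution of this system provides a Hessian, and any other
    one has the same coefficients. *)
Lemma FE_hessian_lincomb u a b :
  (fun x => FE_hessian Omega T p n (lincomb Phi0 u) x a b) =
  lincomb Phi (invmx M *m C a b *m u) %[ae mu in Omega] /\
  FE (fun x => FE_hessian Omega T p n (lincomb Phi0 u) x a b).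
Proof.
set V := lincomb Phi0 u; have [FV _] := lincomb_FE0 u.
have coefP a' b' c :
    (forall i, inner (lincomb Phi c) (Phi i) = hess_form a' b' V (Phi i)) <->
    c = invmx M *m C a' b' *m u.
  have iffE : (c = invmx M *m C a' b' *m u) <-> (M *m c = C a' b' *m u).
    split=> [->|e]; last by rewrite -mulmxA -e mulKmx// matM_unit.
    by rewrite !mulmxA mulmxV ?mul1mx// matM_unit.
  apply: iff_trans _ (iff_sym iffE).
  split=> [h|e i]; first by apply/colP => i; rewrite matM_lincomb matC_lincomb.
  by rewrite -matM_lincomb e matC_lincomb.
have : is_FE_hessian Omega T p n V (FE_hessian Omega T p n V).
  rewrite /FE_hessian; case: xgetP => [H -> //|/(_ (fun x =>
    \matrix_(a', b') lincomb Phi (invmx M *m C a' b' *m u) x)) nH].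
  exfalso; apply: nH; apply/is_FE_hessianE.
  have HE a' b' : (fun x =>
      (\matrix_(a', b') lincomb Phi (invmx M *m C a' b' *m u) x) a' b') =
      lincomb Phi (invmx M *m C a' b' *m u).
    by apply/funext => x; rewrite mxE.
  split=> [a' b'|Psi FPsi a' b']; rewrite HE; first exact: lincomb_FE.
  set c := _ *m u; have hc := (coefP a' b' c).2 erefl.
  have [_ _ /(_ Psi FPsi)[e Psie]] := Phi_basis.
  rewrite (hess_form_aer _ _ _ FPsi (lincomb_FE e) Psie) innerC.
  rewrite (inner_ae_l mO (FE_L2 FPsi) (FE_L2 (lincomb_FE e))
    (FE_L2 (lincomb_FE c)) Psie).
  rewrite inner_lincomb//; [|by move=> j; exact: FE_L2|exact/FE_L2/lincomb_FE].
  rewrite (lincomb_functional (L := hess_form a' b' V) in_FE_0 FE_linear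
    _ _ Phi_FE); last by move=> r V' W FV' FW; exact: hess_form_linr.
  by apply: eq_bigr => j _; rewrite innerC hc.
move=> /is_FE_hessianE[FH HH]; split=> //.
have [_ _ /(_ _ (FH a b))[c Hc]] := Phi_basis.
suff <- : c = invmx M *m C a b *m u by [].
apply/coefP => i; rewrite -HH//; apply/esym.
apply: (inner_ae_l mO) => //; [exact: FE_L2|exact/FE_L2/lincomb_FE|exact: FE_L2].
Qed.

Section system.
Variables (A : 'rV[R]_d.+1 -> 'M[R]_d.+1) (f : 'rV[R]_d.+1 -> R).
Hypothesis A_Loo : forall a b, in_L Omega +oo%E (fun x => A x a b).
Hypothesis f_L2 : L2 f.
Local Notation D := (matD Omega T n A Phi0 Phib).

Let AH u x := \tr ((A x)^T *m FE_hessian Omega T p n (lincomb Phi0 u) x).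

Lemma AH_L2 u : L2 (AH u).
Proof.
have -> : AH u = (fun x => \sum_b \sum_a
    (A x a b * FE_hessian Omega T p n (lincomb Phi0 u) x a b)).
  apply/funext => x; apply: eq_bigr => b _; rewrite mxE.
  by apply: eq_bigr => a _; rewrite mxE.
apply: in_L2_sum => b; apply: in_L2_sum => a; apply: in_Loo_mul_L2 => //.
by apply: FE_L2; have [_] := FE_hessian_lincomb u a b.
Qed.

Lemma matD_lincomb u i : (D *m u) i 0 = inner (AH u) (Phi0 i).
Proof.
have LH a b := FE_L2 (FE_hessian_lincomb u a b).2.
have LP := FE_L2 (Phi0_FE i).
have LAH a b := in_Loo_mul_L2 mO (A_Loo a b) (LH a b).
have -> : AH u = (fun x => \sum_b \sum_a
    (A x a b * FE_hessian Omega T p n (lincomb Phi0 u) x a b)).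
  apply/funext => x; apply: eq_bigr => b _; rewrite mxE.
  by apply: eq_bigr => a _; rewrite mxE.
rewrite inner_suml//; last by move=> b; apply: in_L2_sum.
under [RHS]eq_bigr do rewrite inner_suml//.
rewrite exchange_big /= /matD mulmx_suml summxE; apply: eq_bigr => a _.
rewrite mulmx_suml summxE; apply: eq_bigr => b _.
set c := invmx M *m C a b *m u.
have LAP j := in_Loo_mul_L2 mO (A_Loo a b) (FE_L2 (Phi_FE j)).
have -> : inner (fun x =>
     A x a b * FE_hessian Omega T p n (lincomb Phi0 u) x a b) (Phi0 i) =
   inner (lincomb (fun j x => A x a b * Phi j x) c) (Phi0 i).
  apply: (inner_ae_l mO) => //.
    by apply: in_L2_sum => j; exact: in_L2Z.
  have [e _] := FE_hessian_lincomb u a b; apply: filterS e => x /= h Ox.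
  rewrite h// /lincomb mulr_sumr; apply: eq_bigr => j _; rewrite -/c; ring.
have -> : matB Omega A Phi0 Phib a b *m invmx M *m C a b *m u =
    matB Omega A Phi0 Phib a b *m c by rewrite /c !mulmxA.
rewrite inner_lincomb// [LHS]mxE.
by apply: eq_bigr => j _; rewrite mxE mulrC; congr (_ * _); exact: innerC.
Qed.

Lemma NVFEM_lincomb u : NVFEM_solution Omega T p n A f (lincomb Phi0 u) <->
  D *m u = vecf Omega f Phi0.
Proof.
split=> [[_ sol]|Du].
  apply/colP => i; rewrite matD_lincomb mxE; exact: sol.
split; first exact: lincomb_FE0.
move=> Psi FPsi; rewrite -[LHS]/(inner (AH u) Psi) -[RHS]/(inner f Psi).
have [_ _ /(_ Psi FPsi)[e Psie]] := Phi0_basis.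
have [FPsi' _] := FPsi; have [Fe _] := lincomb_FE0 e.
rewrite innerC (inner_ae_l mO (FE_L2 FPsi') (FE_L2 Fe) (AH_L2 u) Psie).
rewrite [RHS]innerC (inner_ae_l mO (FE_L2 FPsi') (FE_L2 Fe) f_L2 Psie).
have LP j := FE_L2 (Phi0_FE j).
rewrite !inner_lincomb//; last exact: AH_L2.
apply: eq_bigr => i _; congr (_ * _).
move/colP: Du => /(_ i); rewrite matD_lincomb mxE innerC => ->; exact: innerC.
Qed.

(** The sets of Hessians of [V] and [W] coincide, so the choice operator selects
    the same element of both. *)
Lemma FE_hessian_ae V W : FE V -> FE W -> V = W %[ae mu in Omega] ->
  FE_hessian Omega T p n V = FE_hessian Omega T p n W.
Proof.
move=> FV FW VW.
have E a b Psi := hess_form_ael a b Psi FV FW VW.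
have sub V1 V2 : (forall a b Psi, hess_form a b V1 Psi = hess_form a b V2 Psi) ->
    [set H | is_FE_hessian Omega T p n V1 H] `<=`
    [set H | is_FE_hessian Omega T p n V2 H].
  move=> E12 H /is_FE_hessianE[FH HH]; apply/is_FE_hessianE; split; first exact: FH.
  by move=> Psi FPsi a b; rewrite -E12; exact: (HH Psi FPsi a b).
have e : [set H | is_FE_hessian Omega T p n V H] =
    [set H | is_FE_hessian Omega T p n W H].
  rewrite eqEsubset; split; first exact: (sub _ _ E).
  exact: (sub _ _ (fun a b Psi => esym (E a b Psi))).
exact: (congr1 (xget (fun=> 0)) e).
Qed.

Lemma NVFEM_solution_lincomb U : NVFEM_solution Omega T p n A f U ->
  exists u, U = lincomb Phi0 u %[ae mu in Omega] /\ D *m u = vecf Omega f Phi0.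
Proof.
move=> [FU sol]; have [_ _ /(_ U FU)[u Uu]] := Phi0_basis.
exists u; split=> //; apply/NVFEM_lincomb; split; first exact: lincomb_FE0.
have [FU' _] := FU; have [Fu _] := lincomb_FE0 u.
by move=> Psi FPsi; rewrite -(FE_hessian_ae FU' Fu Uu); exact: (sol Psi FPsi).
Qed.

End system.
End basis.
End discrete_hessian.

Theorem theorem2p6 (R : realType) (d : nat)
  (Omega : set 'rV[R]_d.+1)
  (Omega_open : open Omega) (Omega_bounded : bounded_set Omega)
  (Omega_lipschitz : lipschitz_boundary Omega)
  (A : 'rV[R]_d.+1 -> 'M[R]_d.+1) (A_hyp : coef_matrix_hyp Omega A)
  (f : 'rV[R]_d.+1 -> R) (f_L2 : in_L Omega 2%:E f)
  (nT : nat) (T : 'I_nT -> 'M[R]_(d.+2, d.+1))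
  (T_conforming : conforming_triangulation Omega T)
  (n : 'rV[R]_d.+1 -> 'rV[R]_d.+1) (n_normal : outward_normal_field Omega T n)
  (p : nat) (p_ge1 : (1 <= p)%N)
  (N0 Nb : nat)
  (Phi0 : 'I_N0 -> 'rV[R]_d.+1 -> R) (Phib : 'I_Nb -> 'rV[R]_d.+1 -> R)
  (Phi0_basis : is_basis Omega (in_FE0 Omega T p) Phi0)
  (Phi_basis : is_basis Omega (in_FE Omega T p) (full_basis Phi0 Phib)) :
  [/\ matM Omega Phi0 Phib \in unitmx,
      forall u : 'cV[R]_N0,
        NVFEM_solution Omega T p n A f (lincomb Phi0 u) <->
        matD Omega T n A Phi0 Phib *m u = vecf Omega f Phi0 &
      forall U, NVFEM_solution Omega T p n A f U ->
        exists u : 'cV[R]_N0,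
          U = lincomb Phi0 u %[ae (lebesgue_rV d.+1) in Omega] /\
          matD Omega T n A Phi0 Phib *m u = vecf Omega f Phi0].
Proof.
have [A_Loo _ _ _] := A_hyp.
split; first exact: (matM_unit Omega_open Omega_bounded Phi_basis).
- move=> u; exact: (NVFEM_lincomb Omega_open Omega_bounded T_conforming
    n_normal Phi0_basis Phi_basis A_Loo f_L2 u).
- move=> U; exact: (NVFEM_solution_lincomb Omega_open Omega_bounded
    T_conforming n_normal Phi0_basis Phi_basis A_Loo f_L2).
Qed.
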